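(* Let $\rho\in(0,+\infty)$ and let $\Pi_\rho:=[0,1]\times[0,\rho]^3\times[-\rho,0]$. Assume the following conditions hold. (a) $f:\Pi_\rho\to\mathbb{R}$ is continuous and there exists a continuous function $\underline{\delta}_\rho:[0,1]\to[0,+\infty)$ such that $$f(t,u,v,w,z)\ge \underline{\delta}_\rho(t)\quad\text{for every }(t,u,v,w,z)\in\Pi_\rho.$$ (b) $H:\overline{K}_\rho\to\mathbb{R}$ is continuous and bounded, and $\underline{\eta}_\rho\in[0,+\infty)$ is such that $$H[u]\ge\underline{\eta}_\rho\quad\text{for every }u\in\partial K_\rho.$$ (c) The inequality $$\underline{\eta}_\rho+\int_0^1\underline{\delta}_\rho(s)\,ds>0$$ holds. (d) There exists a continuous function $\overline{\delta}_\rho:[0,1]\to[0,+\infty)$ such that $$f(t,u,v,w,z)\le\overline{\delta}_\rho(t)\quad\text{for every }(t,u,v,w,z)\in\Pi_\rho.$$ (e) $\overline{\eta}_\rho\in[0,+\infty)$ is such that $$H[u]\le\overline{\eta}_\rho\quad\text{for every }u\in\partial K_\rho.$$ Then the boundary value problem $$\begin{cases}u^{(4)}(t)=\lambda f(t,u(t),u'(t),u''(t),u'''(t)),\quad t\in(0,1),\\ u(0)=u'(0)=u''(1)=0,\\ u'''(1)+\lambda H[u]=0,\end{cases}$$ has a positive eigenvalue $\lambda_\rho$ with an associated eigenfunction $u_\rho\in\partial K_\rho$, and $\lambda_\rho$ satisfies the estimates $$\frac{\rho}{\overline{\eta}_\rho+\int_0^1\overline{\delta}_\rho(s)\,ds}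\le\lambda_\rho\le\frac{\rho}{\underline{\eta}_\rho+\int_0^1\underline{\delta}_\rho(s)\,ds}.$$
   Context: The space $C^3[0,1]$ of real-valued functions is endowed with the norm $\|u\|_3:=\max_{j=0,\ldots,3}\|u^{(j)}\|_\infty$, where $\|w\|_\infty=\sup_{t\in[0,1]}|w(t)|$. The cone $K$ is $$K:=\{u\in C^3[0,1]:\ u(t),\,u'(t),\,u''(t),\,-u'''(t)\ge 0\ \text{for every }t\in[0,1]\}.$$ For $\rho\in(0,+\infty)$ set $\overline{K}_\rho:=\{u\in K:\|u\|_3\le\rho\}$ and $\partial K_\rho:=\{u\in K:\|u\|_3=\rho\}$. Definition of eigenvalue: let $$k(t,s)=\begin{cases}\frac16(3t^2s-t^3), & s\ge t,\\ \frac16(3s^2t-s^3), & s\le t,\end{cases}\qquad \gamma(t)=\frac16(3t^2-t^3).$$ A number $\lambda$ is an eigenvalue of the boundary value problem with a corresponding eigenfunction $u\in C^3[0,1]$, $\|u\|_3>0$, if the pair $(u,\lambda)$ satisfies the perturbed Hammerstein integral equation $$u(t)=\lambda\Bigl(\gamma(t)H[u]+\int_0^1 k(t,s)f(s,u(s),u'(s),u''(s),u'''(s))\,ds\Bigr),\quad t\in[0,1].$$ *)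

(* Defs.v *)
From mathcomp Require Import all_boot all_order all_algebra.
From mathcomp Require Import all_classical all_reals all_analysis.

Set Implicit Arguments.
Unset Strict Implicit.
Unset Printing Implicit Defensive.

Import Order.TTheory GRing.Theory Num.Theory.
Import numFieldNormedType.Exports.

Local Open Scope classical_set_scope.
Local Open Scope ring_scope.

Section C3.
Context {R : realType}.
Implicit Types (u : R -> R) (t s rho lambda : R).

(* Elements of C^3[0,1] are represented by functions u : R -> R of which only
   the values on [0,1] matter: derivatives are taken relative to [0,1], hence
   one-sidedly at 0 and 1. *)
Definition diffquot u t s : R := (u s - u t) / (s - t).

Definition nbhs01 t : set_system R := within `[0, 1] t^'.

Definition derivable01 u t : Prop := cvg (diffquot u t @ nbhs01 t).

Definition D01 u t : R := lim (diffquot u t @ nbhs01 t).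

Definition D01n (n : nat) u : R -> R := iter n D01 u.

Definition is_C3 u : Prop :=
  (forall j t, (j < 3)%N -> t \in `[0, 1] -> derivable01 (D01n j u) t) /\
  {within `[0, 1], continuous (D01n 3 u)}.

Definition supnorm01 u : R := sup [set `|u t| | t in `[0, 1]].

Definition norm3 u : R := \big[Num.max/0]_(j < 4) supnorm01 (D01n j u).

Definition coneK : set (R -> R) := [set u | is_C3 u /\
  forall t, t \in `[0, 1] ->
    [/\ 0 <= u t, 0 <= D01n 1 u t, 0 <= D01n 2 u t & 0 <= - D01n 3 u t]].

Definition closedK rho : set (R -> R) := [set u | coneK u /\ norm3 u <= rho].

Definition boundaryK rho : set (R -> R) := [set u | coneK u /\ norm3 u = rho].

Definition Pibox rho : set (R * R * R * R * R) :=
  `[0, 1] `*` `[0, rho] `*` `[0, rho] `*` `[0, rho] `*` `[- rho, 0].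

(* Continuity on A for the distance norm3 (u - v).  On A included in C^3[0,1]
   it forces H u to depend only on the restriction of u to [0,1]. *)
Definition norm3_continuous_on (A : set (R -> R)) (H : (R -> R) -> R) : Prop :=
  forall u, A u -> forall e : R, 0 < e ->
    exists2 d : R, 0 < d &
      forall v, A v -> norm3 (v - u) < d -> `|H v - H u| < e.

Definition green t s : R :=
  if t <= s then (3 * t ^+ 2 * s - t ^+ 3) / 6
  else (3 * s ^+ 2 * t - s ^+ 3) / 6.

Definition gamma01 t : R := (3 * t ^+ 2 - t ^+ 3) / 6.

(* Eigenvalues and eigenfunctions of the boundary value problem
     u'''' = lambda f(t, u, u', u'', u''') on (0,1),
     u(0) = u'(0) = u''(1) = 0,  u'''(1) + lambda H[u] = 0
   are defined through the associated perturbed Hammerstein equation. *)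
Definition bvp_eigenpair (f : R * R * R * R * R -> R) (H : (R -> R) -> R)
    lambda u : Prop :=
  [/\ is_C3 u, 0 < norm3 u &
    forall t, t \in `[0, 1] ->
      u t = lambda * (gamma01 t * H u +
        \int[lebesgue_measure]_(s in `[0, 1])
          (green t s *
           f (s, u s, D01n 1 u s, D01n 2 u s, D01n 3 u s)))].

End C3.

(* Main.v *)
Require Import Defs.
From mathcomp Require Import all_boot all_order all_algebra.
From mathcomp Require Import all_classical all_reals all_analysis.
From mathcomp Require Import ring lra.
Import Order.TTheory GRing.Theory Num.Theory.
Import numFieldNormedType.Exports.

(** Write [v = - u''']. The boundary conditions determine [u] from [v] by three
    integrations ([beam]), and the Hammerstein equation with parameter [lambda]
    becomes
      [v t = lambda * (H u + int_t^1 f(s, u, u', u'', u''') ds)].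
    For nonnegative nonincreasing [v] the [C^3] norm of [u] is [v 0], so
    [u] lies on the boundary of radius [rho] exactly when [v 0 = rho]; at
    [t = 0] the equation then forces [lambda = rho / (H u + int_0^1 f)].
    Eliminating [lambda] leaves the fixed-point equation [v = shear v] with
      [shear v t = rho * (H u + int_t^1 f) / (H u + int_0^1 f)].
    Since the denominator is at least [eta_lo + int delta_lo > 0] and [f] is
    bounded, [shear] maps nonincreasing nonnegative functions starting at [rho]
    to such functions with a fixed Lipschitz constant ([shear_profile]), and it
    is continuous ([shear_continuous]). A Schauder argument gives the fixed
    point, and both estimates on [lambda] are the bounds on the denominator.

    The fixed point comes from combinatorics. The nonincreasing piecewise linear
    functions on a grid that start at [rho] form a simplex, the coordinates being
    the drops between consecutive nodes.
    On a simplex, Scarf's combinatorial theorem on dominating sets of a family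
    of linear orders ([scarf], a parity argument) yields, for an arbitrary
    self-map [g], nearby points [p i] whose [i]-th coordinate hardly exceeds that
    of [g (p i)] ([approximate_brouwer]); no continuity is involved. Those points
    are equi-Lipschitz profiles, so refining the grid and passing to a
    uniform limit ([profile_compact]) produces a fixed point by continuity at
    the limit alone ([profile_fixpoint]).

    Finally the integral equation for [u] follows from the fixed-point equation
    by repeated integration by parts against the Green function
    ([green_identity]). *)

Set Implicit Arguments.
Unset Strict Implicit.
Unset Printing Implicit Defensive.

(** * Scarf's theorem on dominating sets of linear orders *)

Section Scarf.
Local Open Scope nat_scope.
Variables (T I : finType) (r : I -> T -> nat).
Hypothesis r_inj : forall i, injective (r i).
Implicit Types (s : {set T + I}) (x y : T) (i : I).

(** A set [s] of points and orders encodes a set of points together with the set of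
    orders absent from [s]. In this encoding the dominant sets form a simplicial
    complex on [T + I] whose faces of cardinality [#|I|] play the role of the cells
    of a triangulated simplex; the orders in [s] name the boundary faces that the
    cell touches. *)
Definition dominant s : bool :=
  [forall y, exists i, (inr i \notin s) &&
     [forall x, (inl x \in s) ==> (r i y <= r i x)]].

Lemma dominantP s :
  reflect (forall y, exists2 i, inr i \notin s &
             forall x, inl x \in s -> r i y <= r i x)
          (dominant s).
Proof.
apply: (iffP forallP) => [h y|h y].
  have /existsP[i /andP[iNs /forallP h1]] := h y.
  by exists i => // x xs; have := h1 x; rewrite xs.
have [i iNs h1] := h y.
by apply/existsP; exists i; rewrite iNs; apply/forallP => x; apply/implyP/h1.
Qed.

Lemma dominantS s s' : s' \subset s -> dominant s -> dominant s'.
Proof.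
move=> /fintype.subsetP ss' /dominantP h; apply/dominantP => y.
have [i iNs h1] := h y; exists i; first exact: contra (ss' _) iNs.
by move=> x /ss'; exact: h1.
Qed.

(** Faces with [#|I|] elements are those with as many points as absent orders. *)
Lemma card_inl_inr s :
  #|s| + #|[set i | inr i \notin s]| = #|[set x | inl x \in s]| + #|I|.
Proof.
have -> : #|s| = #|[set x | inl x \in s]| + #|[set i | inr i \in s]|.
  rewrite -!sum1_card (bigID (fun z => if z is inl _ then true else false)) /=.
  congr (_ + _).
    rewrite (reindex_omap (@inl T I) (fun z => if z is inl x then Some x else None)).
      by apply: eq_bigl => x; rewrite inE eqxx !andbT.
    by case=> [x|i] //; rewrite andbF.
  rewrite (reindex_omap (@inr T I) (fun z => if z is inr x then Some x else None)).
    by apply: eq_bigl => x; rewrite inE eqxx !andbT.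
  by case=> [x|i] //; rewrite andbF.
rewrite -addnA; congr (_ + _).
rewrite -(cardsC [set i | inr i \in s]); congr (_ + _).
by apply: eq_card => i; rewrite !inE.
Qed.

(** The pseudomanifold property. A dominant set with one point fewer than absent
    orders has each point minimal for some absent order, so exactly one point is
    minimal for two of them, [a] and [b]. Releasing the constraint of one of these
    two orders gives one coface each: either the order is not needed for
    domination and joins the face, or the best point that it alone excluded does. *)
Lemma card_cofaces s x0 : dominant s -> inl x0 \in s -> #|s|.+1 = #|I| ->
  #|[set z | (z \notin s) && dominant (z |: s)]| = 2.
Proof.
move=> sdom x0s scard.
set C := [set i | inr i \notin s].
set S := [set x | inl x \in s].
have CS : #|C| = #|S|.+1.
  apply/eqP; rewrite -(eqn_add2l #|s|) card_inl_inr -scard.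
  by rewrite addnS [X in _ == X]addnS addnC.
have x0S : x0 \in S by rewrite inE.
pose m i := [arg min_(x < x0 in S) r i x].
have mS i : m i \in S by rewrite /m; case: arg_minnP.
have mle i x : x \in S -> r i (m i) <= r i x.
  by rewrite /m; case: arg_minnP => // y yS h; exact: h.
have muniq i x : x \in S -> (forall y, y \in S -> r i x <= r i y) -> m i = x.
  move=> xS h; apply: (@r_inj i); apply/eqP; rewrite eqn_leq mle//=.
  exact: h.
(* a set of orders for which every point of [S] is a minimum maps onto [S] *)
have surj (D : {set I}) : D \subset C ->
    (forall x, x \in S -> exists2 i, i \in D & m i = x) -> m @: D = S.
  move=> DC h; apply/eqP; rewrite finset.eqEsubset; apply/andP; split.
    by apply/fintype.subsetP => _ /imsetP[i _ ->].
  by apply/fintype.subsetP => x /h[i iD <-]; exact: imset_f.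
have surjC : m @: C = S.
  apply: surj => // x xS; have [i iNs h] := dominantP _ sdom x.
  exists i; first by rewrite inE.
  by apply: muniq => // y; rewrite inE; exact: h.
have [a [b [aC bC ab mab]]] : exists a b, [/\ a \in C, b \in C, a != b & m a = m b].
  have : ~~ [forall a in C, forall b in C, (m a == m b) ==> (a == b)].
    apply/negP => h.
    have minj : {in C &, injective m}.
      move=> a b aC bC mab; apply/eqP.
      by move: h => /'forall_implyP/(_ a aC)/'forall_implyP/(_ b bC); rewrite mab eqxx.
    have := card_in_imset minj.
    by rewrite surjC CS => /n_Sn.
  rewrite negb_forall_in => /existsP[a /andP[aC]].
  rewrite negb_forall_in => /existsP[b /andP[bC]].
  by rewrite negb_imply => /andP[/eqP mab ab]; exists a, b.
have surjD c : c \in [set a; b] -> m @: (C :\ c) = S.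
  move=> cab; apply: surj; first exact: finset.subsetDl.
  move=> x; rewrite -surjC => /imsetP[i iC ->].
  have [->|ic] := eqVneq i c; last by exists i => //; rewrite in_setD1 ic iC.
  move: cab; rewrite !inE => /orP[/eqP->|/eqP->].
    by exists b => //; rewrite in_setD1 bC eq_sym ab.
  by exists a => //; rewrite in_setD1 aC ab.
have injD c : c \in C -> m @: (C :\ c) = S -> {in C :\ c &, injective m}.
  move=> cC mCc; apply/imset_injP.
  by rewrite mCc -(inj_eq succn_inj) -CS (cardsD1 c) cC.
have inab c : c \in C -> m @: (C :\ c) = S -> c \in [set a; b].
  move=> cC mCc; rewrite !inE; apply: contraT; rewrite negb_or => /andP[ca cb].
  have := injD _ cC mCc a b; rewrite !in_setD1 aC bC !(eq_sym _ c) ca cb.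
  by move=> /(_ isT isT mab) /eqP; rewrite (negbTE ab).
have abC c : c \in [set a; b] -> c \in C.
  by rewrite !inE => /orP[/eqP->|/eqP->]; move: aC bC; rewrite !inE.
(* the points that only the order [c] excludes *)
pose M c := [set y | [forall i in C :\ c, r i (m i) < r i y]].
have MP c y : reflect (forall i, i \in C -> i != c -> r i (m i) < r i y) (y \in M c).
  rewrite inE; apply: (iffP 'forall_implyP) => h i.
    by move=> iC ic; apply: h; rewrite in_setD1 ic.
  by rewrite in_setD1 => /andP[ic iC]; exact: h.
have MNP c y : y \notin M c -> exists i, [/\ i \in C, i != c & r i y <= r i (m i)].
  rewrite inE negb_forall_in => /existsP[i /andP[]].
  by rewrite in_setD1 -leqNgt => /andP[ic iC] h; exists i.
(* the coface obtained by releasing the order [c] *)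
pose ext c : T + I := if [pick y in M c] is Some y
  then inl [arg max_(t > y in M c) r c t] else inr c.
have extP c : (M c =i pred0 /\ ext c = inr c) \/
   (exists t, [/\ t \in M c, forall y, y \in M c -> r c y <= r c t & ext c = inl t]).
  rewrite /ext; case: pickP => [y yM|M0]; last by left.
  by right; case: arg_maxnP => // t tM h; exists t.
have dom_ext c : c \in [set a; b] -> ext c \notin s /\ dominant (ext c |: s).
  move=> cab; have cC := abC _ cab; case: (extP c) => [[M0 ->]|[t [tM tmax ->]]].
    split; first by move: cC; rewrite inE.
    apply/dominantP => y; have [|i [iC ic h]] := MNP c y; first by rewrite M0.
    exists i; first by rewrite !inE negb_or; move: iC ic; rewrite inE => -> ->.
    by move=> x; rewrite !inE /= => xs; rewrite (leq_trans h)// mle// inE.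
  have cmin : r c t <= r c (m c).
    have [i iNs h] := dominantP _ sdom t.
    have [->|ic] := eqVneq c i; first by apply: h; have := mS i; rewrite inE.
    have iC : i \in C by rewrite inE.
    have := MP c t tM i iC; rewrite eq_sym ic => /(_ isT).
    by rewrite ltnNge h//; have := mS i; rewrite inE.
  split.
    apply/negP => ts.
    have : t \in m @: (C :\ c) by rewrite surjD// inE.
    move=> /imsetP[i]; rewrite in_setD1 => /andP[ic iC] tm.
    by have := MP c t tM i iC ic; rewrite tm ltnn.
  apply/dominantP => y; have [yM|yM] := boolP (y \in M c).
    exists c; first by rewrite !inE; move: cC; rewrite inE.
    move=> x; rewrite !inE => /orP[/eqP[->]|xs]; first exact: tmax.
    by rewrite (leq_trans (tmax _ yM))// (leq_trans cmin)// mle// inE.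
  have [i [iC ic h]] := MNP _ _ yM.
  exists i; first by rewrite !inE; move: iC; rewrite inE.
  move=> x; rewrite !inE => /orP[/eqP[->]|xs]; last by rewrite (leq_trans h)// mle// inE.
  by rewrite (leq_trans h)// ltnW// (MP c t tM i iC ic).
have ext_uniq z : z \notin s -> dominant (z |: s) -> exists2 c, c \in [set a; b] & z = ext c.
  case: z => [t|c] zNs /dominantP zdom.
    have tS : t \notin S by rewrite inE.
    have [c cN cmin] := zdom t.
    have cC : c \in C by move: cN; rewrite !inE.
    have minS' x : x \in S -> exists i, [/\ i \in C, i != c, m i = x & r i x <= r i t].
      move=> xS; have [i iN h] := zdom x; exists i; split.
      - by move: iN; rewrite !inE.
      - apply: contra tS => /eqP ic; suff -> : t = x by [].
        apply: (@r_inj i); apply/eqP; rewrite eqn_leq h ?inE ?eqxx//.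
        by rewrite ic cmin// !inE; move: xS; rewrite inE => ->; rewrite orbT.
      - by apply: muniq => // y yS; apply: h; rewrite !inE; move: yS; rewrite inE => ->; rewrite orbT.
      - by apply: h; rewrite !inE eqxx.
    have mCc : m @: (C :\ c) = S.
      apply: surj; first exact: finset.subsetDl.
      by move=> x /minS'[i [iC ic mi _]]; exists i => //; rewrite in_setD1 ic.
    have tM : t \in M c.
      apply/MP => i iC ic.
      have [i' [i'C i'c mi' h]] := minS' _ (mS i).
      have i'i : i' = i by apply: (injD _ cC mCc) => //; rewrite in_setD1 ?ic ?i'c.
      rewrite i'i in h; rewrite ltn_neqAle h andbT; apply: contra tS => /eqP/r_inj <-.
      exact: mS.
    have tmax y : y \in M c -> r c y <= r c t.
      move=> yM; have [i iN h] := zdom y.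
      have [<-|ic] := eqVneq i c; first by apply: h; rewrite !inE eqxx.
      have iC : i \in C by move: iN; rewrite !inE.
      have := MP c y yM i iC ic; rewrite ltnNge h//.
      by rewrite !inE; have := mS i; rewrite inE => ->; rewrite orbT.
    exists c; first exact: inab.
    case: (extP c) => [[M0 _]|[t' [t'M t'max ->]]]; first by rewrite M0 in tM.
    by congr inl; apply: (@r_inj c); apply/eqP; rewrite eqn_leq tmax// t'max.
  have cC : c \in C by rewrite inE.
  have minS x : x \in S -> exists2 i, i \in C :\ c & m i = x.
    move=> xS; have [i iN h] := zdom x; exists i.
      by move: iN; rewrite !inE negb_or.
    by apply: muniq => // y yS; apply: h; rewrite !inE; move: yS; rewrite inE => ->; rewrite orbT.
  have mCc : m @: (C :\ c) = S by apply: surj => //; exact: finset.subsetDl.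
  exists c; first exact: inab.
  case: (extP c) => [[_ ->] //|[t [tM _ _]]].
  have [i iN h] := zdom t.
  have iC : i \in C by move: iN; rewrite !inE negb_or => /andP[].
  have ic : i != c by move: iN; rewrite !inE negb_or => /andP[].
  have := MP c t tM i iC ic; rewrite ltnNge h//.
  by rewrite !inE; have := mS i; rewrite inE => ->; rewrite orbT.
have extab : ext a != ext b.
  case: (extP a) => [[_ ->]|[t [tM _ ->]]]; case: (extP b) => [[_ ->]|[t' [t'M _ ->]]] //.
  apply/negP => /eqP[tt']; have [i iNs h] := dominantP _ sdom t.
  have iC : i \in C by rewrite inE.
  have mis : inl (m i) \in s by have := mS i; rewrite inE.
  have := h _ mis; rewrite leqNgt => /negP; apply.
  have [ia|ia] := eqVneq i a; last exact: (MP a t tM).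
  by rewrite tt'; apply: (MP b t' t'M) => //; rewrite ia.
rewrite (_ : [set _ | _] = [set ext a; ext b]); first by rewrite cards2 extab.
apply/setP => z; rewrite !inE; apply/andP/orP.
  by move=> [zs zd]; have [c] := ext_uniq z zs zd; rewrite !inE => /orP[]/eqP-> ->; [left|right].
by move=> [|] /eqP->; apply: dom_ext; rewrite !inE eqxx ?orbT.
Qed.

(** The face made of all orders but [i0] lies on the boundary: its only coface
    adds the maximum of [T] for [i0]. *)
Lemma card_cofaces_dummy i0 (t0 : T) :
  #|[set z | (z \notin inr @: [set~ i0]) && dominant (z |: inr @: [set~ i0])]| = 1.
Proof.
pose t := [arg max_(t > t0) r i0 t].
have tmax y : r i0 y <= r i0 t by rewrite /t; case: arg_maxnP => // u _ h; exact: h.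
have inlN x : inl x \in inr @: [set~ i0] = false :> bool.
  by apply/negP => /imsetP[].
have inrE i : (inr i \in (inr @: [set~ i0] : {set T + I})) = (i != i0).
  by rewrite mem_imset ?inE//; apply: inr_inj.
have inr0 : inr i0 |: inr @: [set~ i0] = inr @: [set: I] :> {set T + I}.
  by rewrite -imsetU1 finset.setUCr.
apply/eqP/cards1P; exists (inl t); apply/setP => z; rewrite !inE.
apply/andP/eqP => [[zN /dominantP zdom]|->].
  case: z zN zdom => [y|i]; last first.
    rewrite inrE negbK => /eqP ->; rewrite inr0 => /(_ t0)[j /negP[]].
    exact: imset_f.
  move=> _ /(_ t)[i]; rewrite !inE inrE negbK => /eqP ->.
  move=> /(_ y); rewrite !inE eqxx => /(_ isT) ty.
  by congr inl; apply: (@r_inj i0); apply/eqP; rewrite eqn_leq ty tmax.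
split; first by rewrite inlN.
apply/dominantP => y; exists i0; first by rewrite !inE inrE eqxx.
by move=> x; rewrite !inE inlN orbF => /eqP[->].
Qed.

Variable l : T -> I.
Definition colour (z : T + I) : I := match z with inl x => l x | inr i => i end.

(** If a face of a cell that misses the colour [i0] only is obtained by removing
    [a], then the colour of [a], not being [i0], is repeated exactly once, and
    removing its twin gives the only other such face. *)
Lemma even_doors i0 s : #|s| = #|I| -> colour @: s != [set: I] ->
  2 %| #|[set z in s | colour @: (s :\ z) == [set~ i0]]|.
Proof.
move=> scard sN.
pose D := [set z in s | colour @: (s :\ z) == [set~ i0]].
have [D0|[a]] := set_0Vmem D.
  by rewrite -/D D0 cards0.
rewrite inE => /andP[as_ /eqP ca].
have cardA z : z \in s -> #|s :\ z| = #|[set~ i0]|.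
  move=> zs; apply/eqP; rewrite -(eqn_add2l 1).
  by move: scard; rewrite (cardsD1 z) zs => ->; rewrite cardsC1 add1n prednK//; apply/card_gt0P; exists i0.
have inja : {in s :\ a &, injective colour}.
  by apply/imset_injP; rewrite ca cardA.
have [b bs cab] : exists2 b, b \in s :\ a & colour a = colour b.
  have : colour a \in colour @: (s :\ a).
    rewrite ca !inE; apply: contra sN => /eqP cai0.
    rewrite -(finset.setD1K as_) imsetU1 ca cai0; apply/eqP/setP => i.
    by rewrite !inE; case: eqVneq.
  by move=> /imsetP[b bs ->]; exists b.
have [ba b_s] := setD1P bs.
have cb : colour @: (s :\ b) = [set~ i0].
  rewrite -ca; apply/setP => i; apply/imsetP/imsetP => -[z].
    move=> /setD1P[zb zs] ->; have [->|za] := eqVneq z a; first by exists b.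
    by exists z; rewrite // in_setD1 za.
  move=> /setD1P[za zs] ->; have [->|zb] := eqVneq z b.
    by exists a => //; rewrite in_setD1 eq_sym ba.
  by exists z; rewrite // in_setD1 zb.
rewrite -/D (_ : D = [set a; b]); first by rewrite cards2 eq_sym ba.
apply/setP => z; rewrite !inE; apply/andP/orP => [[zs /eqP cz]|].
  have [za|za] := eqVneq z a; [by left|right]; apply: contraT => zb.
  have /imsetP[y] : colour z \in colour @: (s :\ z).
    by rewrite cz -ca; apply: imset_f; rewrite in_setD1 za.
  move=> /setD1P[yz ys] czy.
  have [ya|ya] := eqVneq y a.
    have := inja z b; rewrite bs in_setD1 za zs => /(_ isT isT) h.
    by rewrite h ?eqxx// in zb; rewrite czy ya cab.
  have := inja z y; rewrite !in_setD1 za zs ya ys => /(_ isT isT czy) zy.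
  by rewrite zy eqxx in yz.
by move=> [] /eqP ->; rewrite ?as_ ?b_s ?ca ?cb.
Qed.

(** Sperner's counting argument: count the pairs of a cell and a facet coloured by
    all colours but [i0]. Each such facet lies in two cells, except the dummy
    facet which lies in one, so the number of pairs is odd; a cell without full
    colouring contributes an even number. *)
Theorem scarf (i0 : I) (t0 : T) :
  exists s, dominant s /\ colour @: s = [set: I].
Proof.
pose cell s := dominant s && (#|s| == #|I|).
have [/existsP[s /andP[/andP[sdom _] /eqP sfull]]|/existsPn nofull] :=
  boolP [exists s, cell s && (colour @: s == [set: I])]; first by exists s.
pose dr s := colour @: s == [set~ i0].
have even_cells : 2 %| \sum_(s | cell s) #|[set z in s | dr (s :\ z)]|.
  apply: dvdn_sum => s cs; apply: even_doors; first by case/andP: cs => _ /eqP.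
  by have := nofull s; rewrite cs.
pose door s := [&& dominant s, #|s|.+1 == #|I| & dr s].
have : \sum_(s | cell s) #|[set z in s | dr (s :\ z)]| =
       \sum_(s | door s) #|[set z | (z \notin s) && dominant (z |: s)]|.
  under eq_bigr do rewrite -sum1_card.
  under [RHS]eq_bigr do rewrite -sum1_card.
  rewrite (exchange_big_dep predT)//= [RHS](exchange_big_dep predT)//=.
  apply: eq_bigr => z _.
  rewrite (reindex_onto (fun s => z |: s) (fun s => s :\ z)); last first.
    by move=> s /andP[_]; rewrite inE => /andP[zs _]; rewrite finset.setD1K.
  apply: eq_bigl => s; rewrite !inE eqxx /=.
  have [zs|zs] := boolP (z \in s) => /=.
    rewrite !andbF; apply/negbTE/negP => /andP[_ /eqP h].
    by move: zs; rewrite -h !inE eqxx.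
  rewrite finset.setU1K// eqxx andbT /cell /door cardsU1 zs add1n.
  have [zdom|] := boolP (dominant _); last by rewrite !andbF.
  by rewrite (dominantS (finset.subsetUr _ _) zdom) /= andbT.
set d0 := [set inr i | i in [set~ i0]] : {set T + I}.
have doord0 : door d0.
  rewrite /door /dr -imset_comp imset_id eqxx andbT card_imset; last exact: inr_inj.
  rewrite cardsC1 prednK ?eqxx ?andbT; last by apply/card_gt0P; exists i0.
  apply/dominantP => y; exists i0.
    by rewrite mem_imset ?inE ?eqxx//; exact: inr_inj.
  by move=> x /imsetP[].
move=> h; move: even_cells; rewrite h (bigD1 d0)//= card_cofaces_dummy//.
rewrite dvdn_addl; first by [].
apply: dvdn_sum => s /andP[/and3P[sdom /eqP scard /eqP sdr] sd0].
have [x xs|x0] := pickP (fun x => inl x \in s); first by rewrite (card_cofaces (x0 := x)).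
case/eqP: sd0; apply/setP => -[x|i].
  by rewrite x0; apply/esym/negbTE/negP => /imsetP[].
rewrite mem_imset; last exact: inr_inj.
rewrite -sdr; apply/idP/imsetP => [si|[[x|j] js ->]]; first by exists (inr i).
  by rewrite x0 in js.
by [].
Qed.

End Scarf.

(** Scarf's theorem for the grid [{x | \sum_i x i = N}] ordered by each
    coordinate. Domination says that no grid point exceeds in every absent
    coordinate [i] the minimum [b i] over the dominant set, hence that
    [\sum_i b i] is almost [N]; so the points of the set are within [#|I|] of
    each other, and coordinates outside the absent orders are at most [#|I|]. *)
Lemma grid_colouring (I : finType) (i0 : I) (N : nat)
    (l : {ffun I -> 'I_N.+1} -> I) :
  exists p : I -> {ffun I -> 'I_N.+1},
    [/\ forall k, (\sum_i p k i = N)%N,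
        forall k k' j, (p k j <= p k' j + #|I|)%N &
        forall i, l (p i) = i \/ (p i i <= #|I|)%N].
Proof.
pose T := {x : {ffun I -> 'I_N.+1} | (\sum_i x i == N)%N}.
have mkT (y : I -> nat) : (\sum_i y i = N)%N -> exists x : T, forall i, val x i = y i :> nat.
  move=> yN; have yle i : (y i < N.+1)%N by rewrite ltnS -yN (bigD1 i)//= leq_addr.
  have h : (\sum_i [ffun i => Ordinal (yle i)] i == N)%N.
    by under eq_bigr do rewrite ffunE /=; apply/eqP.
  by exists (Sub [ffun i => Ordinal (yle i)] h : T) => i; rewrite SubK ffunE.
have [t0 _] : exists x : T, forall i, val x i = (if i == i0 then N else 0) :> nat.
  by apply: mkT; rewrite -big_mkcond big_pred1_eq.
(* ties between coordinates are broken by an enumeration of the grid *)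
pose r (i : I) (x : T) : nat := (val x i * #|{: T}| + enum_rank x)%N.
have r_le i x y : (r i x <= r i y)%N -> (val x i <= val y i)%N.
  move=> h; rewrite -ltnS -(@ltn_pmul2r #|{: T}|); last by apply/card_gt0P; exists t0.
  rewrite mulSnr (leq_ltn_trans (leq_trans (leq_addr _ _) h))// ltn_add2l.
  exact: ltn_ord.
have r_inj i : injective (r i).
  move=> x y rxy; apply: enum_rank_inj; apply: val_inj => /=.
  have xy : val x i = val y i :> nat.
    by apply/eqP; rewrite eqn_leq !r_le// rxy.
  by move: rxy; rewrite /r xy; exact: addnI.
have [s [sdom scol]] := scarf r_inj (fun x : T => l (val x)) i0 t0.
have colS i : inr i \notin s -> exists2 x : T, inl x \in s & l (val x) = i.
  move=> iNs; have : i \in colour (fun x : T => l (val x)) @: s by rewrite scol.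
  move=> /imsetP[[x|j] js ij]; first by exists x.
  by rewrite ij js in iNs.
have [x0 x0s] : exists x : T, inl x \in s.
  have [i /colS[x xs _] _] := dominantP _ _ sdom t0; by exists x.
pose xm i := [arg min_(x < x0 | inl x \in s) val x i].
pose b i : nat := if inr i \in s then 0 else val (xm i) i.
have b_le i x : inl x \in s -> (b i <= val x i)%N.
  by rewrite /b /xm; case: ifP => // _ xs; case: arg_minnP => // y _; exact.
have b_sum : (N < \sum_i b i + #|I|)%N.
  rewrite ltnNge; apply/negP => h.
  have [|y yE] := mkT (fun i => (b i).+1 + if i == i0 then N - (\sum_i b i + #|I|) else 0)%N.
    rewrite big_split /= -[X in (_ + X)%N]big_mkcond big_pred1_eq.
    under eq_bigr do rewrite -addn1.
    by rewrite big_split /= sum1_card subnKC.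
  have [i iNs /(_ (xm i))] := dominantP _ _ sdom y.
  have xs : inl (xm i) \in s by rewrite /xm; case: arg_minnP.
  move=> /(_ xs)/r_le; rewrite yE /b (negbTE iNs) => /(leq_trans (leq_addr _ _)).
  by rewrite ltnn.
have le_b j x : inl x \in s -> (val x j <= b j + #|I|)%N.
  move=> xs; rewrite -(leq_add2r (\sum_(i | i != j) b i)) [leqRHS]addnAC -[X in (_ <= X + _)%N](bigD1 j (P := predT))//=.
  apply: (leq_trans _ (ltnW b_sum)).
  apply: (@leq_trans (\sum_i val x i)%N); last by rewrite (eqP (valP x)).
  rewrite [leqRHS](bigD1 j)//= leq_add2l.
  by apply: leq_sum => i _; exact: b_le.
pose p i := val (odflt x0 [pick x | (inl x \in s) && (l (val x) == i)]).
have pS i : exists2 x : T, inl x \in s & p i = val x.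
  rewrite /p; case: pickP => [x /andP[xs _]|_] /=; first by exists x.
  by exists x0.
exists p; split.
- by move=> k; have [x _ ->] := pS k; exact: (eqP (valP x)).
- move=> k k' j; have [x xs ->] := pS k; have [x' xs' ->] := pS k'.
  by rewrite (leq_trans (le_b j x xs))// leq_add2r b_le.
- move=> i; have [is_|iNs] := boolP (inr i \in s).
    right; have [x xs ->] := pS i.
    by have := le_b i x xs; rewrite /b is_.
  left; rewrite /p; case: pickP => [x /andP[_ /eqP]//|] /=.
  by have [x xs lx] := colS _ iNs => /(_ x); rewrite xs lx eqxx.
Qed.

Local Open Scope classical_set_scope.
Local Open Scope ring_scope.

(** * An approximate Brouwer theorem without continuity *)

Section Brouwer.
Context {R : realType}.

Definition simplex (I : finType) (rho : R) (x : I -> R) : Prop :=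
  (forall i, 0 <= x i) /\ \sum_i x i = rho.

(** Colour a grid point [x] by a coordinate that [g] does not decrease; one exists
    as the coordinates of [x] and of [g x] have the same sum. *)
Lemma approximate_brouwer (I : finType) (i0 : I) (rho eps : R)
    (g : (I -> R) -> I -> R) :
  0 <= rho -> 0 < eps ->
  (forall x, simplex rho x -> simplex rho (g x)) ->
  exists p : I -> I -> R,
    [/\ forall k, simplex rho (p k),
        forall k k' j, p k j <= p k' j + eps &
        forall i, p i i <= g (p i) i + eps].
Proof.
move=> rho0 eps0 gP.
pose N := (Num.truncn (rho * #|I|%:R / eps)).+1.
have N0 : 0 < N%:R :> R by rewrite ltr0n.
have NI : rho * #|I|%:R / N%:R <= eps.
  rewrite ler_pdivrMr// [leRHS]mulrC -ler_pdivrMr//.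
  exact/ltW/truncnS_gt.
pose sc (x : {ffun I -> 'I_N.+1}) (i : I) : R := rho * (x i)%:R / N%:R.
have scP (x : {ffun I -> 'I_N.+1}) : (\sum_i x i = N)%N -> simplex rho (sc x).
  move=> xN; split; first by move=> i; rewrite divr_ge0 ?mulr_ge0 ?ler0n.
  rewrite -mulr_suml -mulr_sumr -natr_sum xN mulfK//.
  by rewrite gt_eqF.
pose l x := odflt i0 [pick i | sc x i <= g (sc x) i].
have lP (x : {ffun I -> 'I_N.+1}) : (\sum_i x i = N)%N ->
    sc x (l x) <= g (sc x) (l x).
  move=> xN; rewrite /l; case: pickP => [i //|no] /=.
  suff : \sum_i g (sc x) i < \sum_i sc x i.
    by rewrite (scP _ xN).2 (gP _ (scP _ xN)).2 ltxx.
  apply: ltr_sum; first by apply/hasP; exists i0; rewrite ?mem_index_enum.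
  by move=> i _; rewrite ltNge no.
have [p [pN pclose pl]] := grid_colouring i0 l.
have sc_le (a b : nat) : (a <= b + #|I|)%N ->
    rho * a%:R / N%:R <= rho * b%:R / N%:R + eps.
  move=> ab; apply: (@le_trans _ _ (rho * (b + #|I|)%:R / N%:R)).
    by rewrite ler_pM2r ?invr_gt0// ler_wpM2l// ler_nat.
  by rewrite natrD mulrDr mulrDl lerD2l.
exists (fun k => sc (p k)); split.
- by move=> k; exact: scP.
- by move=> k k' j; exact/sc_le/pclose.
- move=> i; have [li|pii] := pl i.
    apply: (@le_trans _ _ (g (sc (p i)) i)); last by rewrite lerDl ltW.
    by have := lP _ (pN i); rewrite li.
  have := @sc_le (p i i) 0; rewrite add0n => /(_ pii)/le_trans; apply.
  by rewrite mulr0 mul0r lerD2r; apply: (gP _ (scP _ (pN i))).1.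
Qed.

End Brouwer.

(** * Fixed points among nonincreasing Lipschitz functions *)

Section Profiles.
Context {R : realType}.
Implicit Types (rho L a b t : R) (v w : R -> R) (n j : nat).

(** The candidates for [- u''']; only values on the unit interval matter. *)
Definition profile rho L v : Prop :=
  [/\ v 0 = rho, 0 <= v 1 &
      forall a b, 0 <= a -> a <= b -> b <= 1 -> v b <= v a <= v b + L * (b - a)].

Lemma profile_bounds rho L v t : profile rho L v -> 0 <= t -> t <= 1 ->
  0 <= v t <= rho.
Proof.
move=> [v0 v1 vL] t0 t1.
have /andP[h1 _] := vL _ _ t0 t1 (lexx _).
have /andP[h2 _] := vL _ _ (lexx _) t0 t1.
by rewrite (le_trans v1 h1) -v0 h2.
Qed.

Lemma profile_lipschitz rho L v a b : 0 <= L -> profile rho L v ->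
  0 <= a <= 1 -> 0 <= b <= 1 -> `|v a - v b| <= L * `|a - b|.
Proof.
move=> L0 [_ _ vL]; wlog ab : a b / a <= b.
  move=> h a01 b01; have [ab|/ltW ba] := leP a b; first exact: h.
  by rewrite distrC (distrC a); exact: h.
move=> /andP[a0 a1] /andP[b0 b1].
have /andP[h1 h2] := vL _ _ a0 ab b1.
rewrite ger0_norm ?subr_ge0// distrC ger0_norm ?subr_ge0//.
by rewrite lerBlDl.
Qed.

Lemma profile_weaken rho L L' v : L <= L' -> profile rho L v -> profile rho L' v.
Proof.
move=> LL' [v0 v1 vL]; split=> // a b a0 ab b1.
have /andP[-> h] := vL _ _ a0 ab b1.
by rewrite (le_trans h)// lerD2l ler_wpM2r// subr_ge0.
Qed.

Lemma floor_grid n t : (0 < n)%N -> 0 <= t -> t <= 1 ->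
  exists2 k, (k <= n)%N & `|t - k%:R / n%:R| <= n%:R^-1.
Proof.
move=> n0 t0 t1; have nR : 0 < n%:R :> R by rewrite ltr0n.
exists (Num.truncn (t * n%:R)).
  rewrite -(@ler_nat R); apply: (@le_trans _ _ (t * n%:R)).
    by rewrite truncn_le mulr_ge0// ltW.
  by rewrite ler_piMl// ltW.
have h1 : (Num.truncn (t * n%:R))%:R <= t * n%:R.
  by rewrite truncn_le mulr_ge0// ltW.
have h2 := truncnS_gt (t * n%:R).
rewrite ger0_norm ?subr_ge0 ?ler_pdivrMr//.
rewrite lerBlDl -[X in _ + X]mul1r -mulrDl ler_pdivlMr//.
by rewrite ltW// (lt_le_trans h2)// -natr1.
Qed.

(** Arzela-Ascoli for profiles. Along an ultrafilter finer than the Frechet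
    filter every bounded real sequence converges, which gives a pointwise limit at
    once; the common Lipschitz constant makes the convergence uniform. *)
Lemma profile_compact rho L (w : nat -> R -> R) : 0 <= L ->
  (forall n, profile rho L (w n)) ->
  exists2 v, profile rho L v &
    forall (e : R) N, 0 < e -> exists2 n, (N <= n)%N &
      forall t, 0 <= t -> t <= 1 -> `|w n t - v t| <= e.
Proof.
move=> L0 wP.
have [U [Uu Uoo]] := ultraFilterLemma (eventually_filter : ProperFilter \oo).
have Up : ProperFilter U by exact: ultra_proper.
have lim_ex t : exists l, 0 <= t -> t <= 1 ->
    forall e : R, 0 < e -> \forall n \near U, `|w n t - l| < e.
  have [t01|t01] := boolP (0 <= t <= 1); last first.
    by exists 0 => t0 t1; rewrite t0 t1 in t01.
  have : compact `[0, rho] by exact: segment_compact.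
  move=> /(_ ((fun n => w n t) @ U)) [].
    change (U [set n | [set` `[0, rho]] (w n t)]).
    apply: filterE => n; have /andP[t0 t1] := t01.
    by rewrite /= in_itv /=; exact: (profile_bounds (wP n) t0 t1).
  move=> l [_ wl]; exists l => _ _ e e0.
  have [//|far] := in_ultra_setVsetC [set n | `|w n t - l| < e] Uu.
  pose S : set R := [set x | ~ `|x - l| < e].
  have Ufar : ((fun n => w n t) @ U) S by exact: far.
  have [x [xfar]] := wl _ _ Ufar (nbhsx_ballx l e e0).
  by rewrite /ball /= distrC => /xfar.
have [v vP] := choice lim_ex.
(* any finite set of inequalities between values of [v] holds up to [e] as it
   does for some [w n] *)
have vapprox t : 0 <= t -> t <= 1 -> forall e, 0 < e -> \forall n \near U, `|w n t - v t| < e.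
  by move=> t0 t1 e; exact: vP.
have le01 : 0 <= 1 :> R by [].
have vprof : profile rho L v.
  split.
  - apply/eqP; rewrite -subr_eq0 -normr_le0; apply/ler_addgt0Pr => e e0.
    have [n] := filter_ex (vapprox 0 (lexx _) le01 e e0).
    by have [-> _ _] := wP n; rewrite distrC add0r => /ltW.
  - apply/ler_addgt0Pr => e e0.
    have [n] := filter_ex (vapprox 1 le01 (lexx _) e e0).
    by have [_ + _] := wP n; rewrite ltr_norml; lra.
  move=> a b a0 ab b1.
  have close e : 0 < e -> exists n, `|w n a - v a| < e /\ `|w n b - v b| < e.
    move=> e0; apply: (@filter_ex _ U); apply: filterI; apply: vapprox => //.
      exact: le_trans ab b1.
    exact: le_trans a0 ab.
  apply/andP; split; apply/ler_addgt0Pr => e e0.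
    have [n [wa wb]] := close _ (divr_gt0 e0 (ltr0n R 2 : 0 < 2)).
    have [_ _ /(_ a b a0 ab b1)] := wP n.
    by move: wa wb; rewrite !ltr_norml; lra.
  have [n [wa wb]] := close _ (divr_gt0 e0 (ltr0n R 2 : 0 < 2)).
  have [_ _ /(_ a b a0 ab b1)] := wP n.
  by move: wa wb; rewrite !ltr_norml; lra.
exists v => // e N e0.

  pose m := (Num.truncn (4 * L / e)).+1.
  have m0 : 0 < m%:R :> R by rewrite ltr0n.
  have mL : L * m%:R^-1 <= e / 4.
    have := truncnS_gt (4 * L / e); rewrite -/m ltr_pdivrMr// => h.
    by rewrite ler_pdivrMr//; lra.
  have m01 (k : 'I_m.+1) : 0 <= (k%:R / m%:R : R) <= 1.
    by rewrite divr_ge0//= ler_pdivrMr// mul1r ler_nat -ltnS.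
  have [n [/= nN wn]] : exists n, (N <= n)%N /\
      forall k : 'I_m.+1, `|w n (k%:R / m%:R) - v (k%:R / m%:R)| < e / 4.
    apply: (@filter_ex _ U); apply: filterI.
      by apply: Uoo; exact: nbhs_infty_ge.
    apply: filter_forall => k; have /andP[k0 k1] := m01 k.
    by apply: vP => //; rewrite divr_gt0.
  exists n => // t t0 t1.
  have [k km tk] := floor_grid (isT : 0 < m)%N t0 t1.
  have := wn (Ordinal (km : (k < m.+1)%N)) => /=.
  set s := k%:R / m%:R in tk *; have s01 : 0 <= s <= 1 := m01 (Ordinal (km : (k < m.+1)%N)).
  have Ltk : L * `|t - s| <= e / 4 by rewrite (le_trans _ mL)// ler_wpM2l.
  have := profile_lipschitz (a := t) (b := s) L0 (wP n); rewrite t0 t1 => /(_ isT s01).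
  have := profile_lipschitz (a := t) (b := s) L0 vprof; rewrite t0 t1 => /(_ isT s01).
  rewrite !ler_norml ltr_norml; lra.
Qed.

Definition clamp01 t : R := Num.min 1 (Num.max 0 t).

Variant clamp01_spec t : R -> Prop :=
  | Clamp01_low of t <= 0 : clamp01_spec t 0
  | Clamp01_mid of 0 <= t & t <= 1 : clamp01_spec t t
  | Clamp01_high of 1 <= t : clamp01_spec t 1.

Lemma clamp01P t : clamp01_spec t (clamp01 t).
Proof.
rewrite /clamp01; have [t0|t0] := leP t 0.
  by rewrite min_r ?ler01//; constructor.
by have [t1|t1] := leP 1 t; constructor => //; exact: ltW.
Qed.

Lemma sum_clamp01 n (y : R) : 0 <= y ->
  \sum_(i < n) clamp01 (i.+1%:R - y) = Num.max 0 (n%:R - y).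
Proof.
move=> y0; elim: n => [|n IH].
  by rewrite big_ord0 max_l// sub0r oppr_le0.
rewrite big_ord_recr /= {}IH -natr1.
have [] := clamp01P; have [] := leP 0 (n%:R - y); have [] := leP 0 (n%:R + 1 - y); lra.
Qed.

(** The piecewise linear function with nodes [j / n] whose drop on the [i]-th cell
    is [x i]. At the last index the clamped factor is constantly 1 on the unit
    interval, so [x n] is the value at 1. *)
Definition interp n (x : 'I_n.+1 -> R) t : R :=
  \sum_i x i * clamp01 (i.+1%:R - n%:R * t).

Lemma interp_node n (x : 'I_n.+1 -> R) j : (0 < n)%N ->
  interp x (j%:R / n%:R) = \sum_(i < n.+1 | (j <= i)%N) x i.
Proof.
move=> n0; rewrite /interp mulrC divfK ?pnatr_eq0 -?lt0n//.
rewrite [RHS]big_mkcond; apply: eq_bigr => i _.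
have [ji|ij] := leqP j i.
  have : j%:R <= i%:R :> R by rewrite ler_nat.
  move=> jiR; have -> : clamp01 (i.+1%:R - j%:R) = 1.
    by rewrite -natr1; case: clamp01P => *; lra.
  by rewrite mulr1.
have : i.+1%:R <= j%:R :> R by rewrite ler_nat.
move=> ijR; have -> : clamp01 (i.+1%:R - j%:R) = 0 by case: clamp01P => *; lra.
by rewrite mulr0.
Qed.

Lemma interp_dist n (x y : 'I_n.+1 -> R) (d : R) t :
  (forall i : 'I_n.+1, `|x i - y i| <= d) ->
  `|interp x t - interp y t| <= n.+1%:R * d.
Proof.
move=> xy; rewrite /interp -sumrB (le_trans (ler_norm_sum _ _ _))//.
have -> : n.+1%:R * d = \sum_(i < n.+1) d by rewrite sumr_const card_ord mulr_natl.
apply: ler_sum => i _; rewrite -mulrBl normrM.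
by case: clamp01P => *; rewrite ?normr0 ?normr1 ?mulr0 ?mulr1 ?(le_trans (normr_ge0 _) (xy i))//;
  rewrite (le_trans _ (xy i))// ler_piMr// ger0_norm.
Qed.

Lemma interp_profile n (x : 'I_n.+1 -> R) rho L : (0 < n)%N ->
  simplex rho x -> (forall i : 'I_n.+1, (i < n)%N -> x i <= L / n%:R) ->
  profile rho L (interp x).
Proof.
move=> n0 [x0 xrho] xL; have nR : 0 < n%:R :> R by rewrite ltr0n.
have mono a b : a <= b -> forall i : 'I_n.+1,
    clamp01 (i.+1%:R - n%:R * b) <= clamp01 (i.+1%:R - n%:R * a).
  move=> ab i; have : n%:R * a <= n%:R * b by rewrite ler_pM2l.
  by do 2 case: clamp01P => *; lra.
split.
- by have := interp_node x 0 n0; rewrite mul0r => ->; rewrite -xrho.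
- by apply: sumr_ge0 => i _; rewrite mulr_ge0//; case: clamp01P.
move=> a b a0 ab b1; apply/andP; split.
  by apply: ler_sum => i _; rewrite ler_wpM2l// mono.
rewrite -lerBlDl /interp -sumrB big_ord_recr /=.
have na0 : 0 <= n%:R * a by rewrite mulr_ge0// ltW.
have nab : n%:R * a <= n%:R * b by rewrite ler_pM2l.
have nb1 : n%:R * b <= n%:R by rewrite -[leRHS]mulr1 ler_pM2l.
have -> : clamp01 (n.+1%:R - n%:R * a) = 1 by rewrite -natr1; case: clamp01P => *; lra.
have -> : clamp01 (n.+1%:R - n%:R * b) = 1 by rewrite -natr1; case: clamp01P => *; lra.
rewrite subrr addr0.
apply: (@le_trans _ _ (L / n%:R * \sum_(i < n)
    (clamp01 (i.+1%:R - n%:R * a) - clamp01 (i.+1%:R - n%:R * b)))).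
  rewrite mulr_sumr; apply: ler_sum => i _; rewrite -mulrBr ler_wpM2r//.
    by rewrite subr_ge0; exact: (mono a b ab (widen_ord (leqnSn n) i)).
  exact: (xL (widen_ord (leqnSn n) i) (ltn_ord i)).
rewrite sumrB !sum_clamp01//; last exact: le_trans nab.
rewrite !max_r; try lra.
by rewrite le_eqVlt; apply/orP; left; apply/eqP; field; rewrite gt_eqF.
Qed.

(** Continued by 0 beyond the last node, so that the last drop is the value at 1
    and the drops of a profile are the coordinates of a point of the simplex. *)
Definition node n w (i : nat) : R := if (i <= n)%N then w (i%:R / n%:R) else 0.

Definition node_drop n w (i : nat) : R := node n w i - node n w i.+1.

Lemma sum_node_drop n w j : (j <= n)%N ->
  \sum_(i < n.+1 | (j <= i)%N) node_drop n w i = w (j%:R / n%:R).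
Proof.
move=> jn; transitivity (\sum_(j <= i < n.+1) - (node n w i.+1 - node n w i)).
  rewrite big_geq_mkord; apply: eq_bigr => i _; exact/esym/opprB.
by rewrite sumrN telescope_sumr ?leqW// /node jn ltnn sub0r opprK.
Qed.

Lemma simplex_node_drop rho L n w : (0 < n)%N -> profile rho L w ->
  simplex rho (fun i : 'I_n.+1 => node_drop n w i).
Proof.
move=> n0 [w0 w1 wL]; have nR : 0 < n%:R :> R by rewrite ltr0n.
split=> [i|]; last first.
  by have := @sum_node_drop n w 0 (leq0n _); rewrite mul0r w0.
have in_ : (i <= n)%N by rewrite -ltnS.
rewrite /node_drop /node in_; case: ltnP => [i_n|ni].
  rewrite subr_ge0; have := wL (i%:R / n%:R) (i.+1%:R / n%:R).
  rewrite divr_ge0//= ler_pM2r ?invr_gt0// ler_nat leqnSn.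
  by rewrite ler_pdivrMr// mul1r ler_nat => /(_ isT isT i_n)/andP[].
have -> : i = n :> nat by apply/eqP; rewrite eqn_leq in_.
by rewrite subr0 divff// gt_eqF.
Qed.

(** [w] is one of the points given by [approximate_brouwer] for the
    map that sends [x] to the drops of [T (interp x)]. For [w] to be close to
    [T v] it suffices that [T] is continuous at [v] and [v] is close to [w]: the
    drops of [w] then exceed those of [T v] by little, while both sum to [rho]. Continuity is
    measured on increments relative to [b - a] because the errors of all [n]
    cells add up. *)
Lemma approximate_fixpoint (T : (R -> R) -> R -> R) rho L n :
  0 <= rho -> 0 <= L ->
  (forall L' v, profile rho L' v -> profile rho L (T v)) ->
  (0 < n)%N ->
  exists2 w, profile rho (L + 2) w &
    forall v (eta eps : R), profile rho (L + 2) v -> 0 <= eps ->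
    (forall w', profile rho (L + 2) w' ->
      (forall t, 0 <= t -> t <= 1 -> `|w' t - v t| <= eta) ->
      forall a b, 0 <= a -> a <= b -> b <= 1 ->
        `|(T w' a - T w' b) - (T v a - T v b)| <= eps * (b - a)) ->
    (forall t, 0 <= t -> t <= 1 -> `|w t - v t| + 2 / n%:R <= eta) ->
    forall t, 0 <= t -> t <= 1 ->
      `|w t - T v t| <= 2 * eps + (2 * L + 6) / n%:R.
Proof.
move=> rho0 L0 TP n0.
have nR : 0 < n%:R :> R by rewrite ltr0n.
have n1 : 1 <= n%:R :> R by rewrite ler1n.
(* the mesh error [e] is taken so small that [n.+1] copies of it still vanish *)
pose e : R := (n%:R ^+ 2)^-1.
have e0 : 0 < e by rewrite invr_gt0 exprn_gt0.
have en : e <= n%:R^-1.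
  by rewrite lef_pV2 ?posrE ?exprn_gt0// expr2 ler_peMl// ltW.
have enn : n.+1%:R * e <= 2 / n%:R.
  rewrite /e ler_pdivrMr ?exprn_gt0// expr2 mulrA divfK ?gt_eqF// -natr1; lra.
have rough (x : 'I_n.+1 -> R) : simplex rho x -> profile rho (n%:R * rho) (interp x).
  move=> xP; apply: interp_profile => // i _.
  by rewrite mulrAC divff ?gt_eqF// mul1r -xP.2 (bigD1 i)//= lerDl sumr_ge0// => k _; exact: xP.1.
pose g (x : 'I_n.+1 -> R) (i : 'I_n.+1) := node_drop n (T (interp x)) i.
have gP x : simplex rho x -> simplex rho (g x).
  by move=> xP; apply: (simplex_node_drop n0 (TP _ _ (rough x xP))).
have [q [qs qclose qg]] := approximate_brouwer (ord0 : 'I_n.+1) rho0 e0 gP.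
(* each drop of [q k] is at most a drop of an [L]-Lipschitz profile plus [2 e] *)
have qP (k : 'I_n.+1) : profile rho (L + 2) (interp (q k)).
  apply: interp_profile => // i i_n.
  have [_ _ TL] := TP _ _ (rough (q i) (qs i)).
  have := TL (i%:R / n%:R) (i.+1%:R / n%:R).
  rewrite divr_ge0//= ler_pM2r ?invr_gt0// ler_nat leqnSn.
  rewrite ler_pdivrMr// mul1r ler_nat => /(_ isT isT i_n)/andP[_].
  have := qclose k i i; have := qg i; rewrite /g /node_drop /node ltnW// i_n.
  rewrite -mulrBl -natrB// subSnn mul1r.
  have : (L + 2) / n%:R = L / n%:R + 2 / n%:R by rewrite mulrDl.
  lra.
exists (interp (q ord0)) => // v eta eps vP eps0 Tclose wv.
have qv (k : 'I_n.+1) t : 0 <= t -> t <= 1 -> `|interp (q k) t - v t| <= eta.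
  move=> t0 t1; apply: le_trans (wv t t0 t1).
  have -> : interp (q k) t - v t =
      (interp (q ord0) t - v t) + (interp (q k) t - interp (q ord0) t) by ring.
  rewrite (le_trans (ler_normD _ _))// lerD2l (le_trans _ enn)//.
  apply: interp_dist => i; rewrite ler_norml.
  by have := qclose k ord0 i; have := qclose ord0 k i; lra.
have {}Tclose k := Tclose _ (qP k) (qv k).
have [Tv0 Tv1 TvL] := TP _ _ vP.
pose c (i : 'I_n.+1) : R := (if (i < n)%N then eps / n%:R else eps) + 2 * e.
have c0 i : 0 <= c i.
  by rewrite /c; case: ifP => _; rewrite addr_ge0 ?mulr_ge0// ?invr_ge0// ltW.
have csum : \sum_i c i <= 2 * eps + 4 / n%:R.
  rewrite big_split /= sumr_const card_ord -[_ *+ n.+1]mulr_natl big_ord_recr /= ltnn.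
  under eq_bigr do rewrite ltn_ord.
  rewrite sumr_const card_ord -[_ *+ n]mulr_natl mulrC divfK ?gt_eqF//.
  by move: enn; lra.
pose d (i : 'I_n.+1) : R := node_drop n (T v) i + c i - q ord0 i.
have d0 i : 0 <= d i.
  have := qclose ord0 i i; have := qg i; rewrite /d /c /g /node_drop /node -ltnS ltn_ord.
  case: ltnP => i_n.
    have := Tclose i (i%:R / n%:R) (i.+1%:R / n%:R).
    rewrite divr_ge0//= ler_pM2r ?invr_gt0// ler_nat leqnSn.
    rewrite ler_pdivrMr// mul1r ler_nat => /(_ isT isT i_n).
    rewrite -mulrBl -natrB// subSnn mul1r ler_norml; lra.
  have -> : i%:R = n%:R :> R by congr _%:R; apply/eqP; rewrite eqn_leq -ltnS ltn_ord.
  rewrite divff ?gt_eqF//.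
  have := Tclose i 0 1 (lexx _) ler01 (lexx _).
  have [-> _ _] := TP _ _ (qP i).
  rewrite Tv0 ler_norml; lra.
(* the nonnegative defects [d] have a small sum, so all partial sums are small *)
have dsum : \sum_i d i = \sum_i c i.
  rewrite /d sumrB big_split /= (qs ord0).2.
  by rewrite (simplex_node_drop n0 (TP _ _ vP)).2 addrAC subrr add0r.
have part_le (h : 'I_n.+1 -> R) j : (forall i, 0 <= h i) ->
    0 <= \sum_(i < n.+1 | (j <= i)%N) h i <= \sum_i h i.
  move=> h0; rewrite sumr_ge0//= [leRHS](bigID (fun i : 'I_n.+1 => (j <= i)%N)) /=.
  by rewrite lerDl sumr_ge0.
have at_node j : (j <= n)%N ->
    `|interp (q ord0) (j%:R / n%:R) - T v (j%:R / n%:R)| <= 2 * eps + 4 / n%:R.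
  move=> jn; rewrite interp_node// -sum_node_drop//.
  have /andP[dl dr] := part_le d j d0; have /andP[cl cr] := part_le c j c0.
  move: dl dr; rewrite dsum /d sumrB big_split /= ler_norml => dl dr; lra.
move=> t t0 t1; have [k kn tk] := floor_grid n0 t0 t1.
have := at_node k kn; set s := k%:R / n%:R in tk *.
have s01 : 0 <= s <= 1 by rewrite divr_ge0//= ler_pdivrMr// mul1r ler_nat.
have := profile_lipschitz (a := t) (b := s) _ (qP ord0); rewrite t0 t1 addr_ge0// => /(_ isT isT s01).
have := profile_lipschitz (a := t) (b := s) L0 (TP _ _ vP); rewrite t0 t1 => /(_ isT s01).
have : L * `|t - s| <= L / n%:R by rewrite ler_wpM2l.
have : (2 * L + 6) / n%:R = 2 * (L / n%:R) + 6 * n%:R^-1 by rewrite mulrDl mulrA.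
rewrite [(L + 2) * _]mulrDl !ler_norml; lra.
Qed.

(** Schauder's theorem for profiles: uniform limits of the
    approximate fixed points are fixed. The constant [L + 2] leaves room for the
    error of the approximants. *)
Theorem profile_fixpoint (T : (R -> R) -> R -> R) rho L :
  0 <= rho -> 0 <= L ->
  (forall L' v, profile rho L' v -> profile rho L (T v)) ->
  (forall v (eps : R), profile rho (L + 2) v -> 0 < eps ->
    exists2 eta : R, 0 < eta & forall w, profile rho (L + 2) w ->
      (forall t, 0 <= t -> t <= 1 -> `|w t - v t| <= eta) ->
      forall a b, 0 <= a -> a <= b -> b <= 1 ->
        `|(T w a - T w b) - (T v a - T v b)| <= eps * (b - a)) ->
  exists2 v, profile rho (L + 2) v &
    forall t, 0 <= t -> t <= 1 -> v t = T v t.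
Proof.
move=> rho0 L0 TP Tcont.
have [w wP] := choice (fun n : nat => (let: ex_intro2 w h1 h2 :=
  approximate_fixpoint rho0 L0 TP (ltn0Sn n) in ex_intro _ w (conj h1 h2))).
have L2 : 0 <= L + 2 by rewrite addr_ge0.
have [v vP wv] := profile_compact L2 (fun n => (wP n).1).
exists v => // t t0 t1; apply/eqP; rewrite -subr_eq0 -normr_le0.
apply/ler_addgt0Pr => e e0; rewrite add0r.
have e8 : 0 < e / 8 by rewrite divr_gt0.
have [eta eta0 Tclose] := Tcont v (e / 8) vP e8.
pose N := Num.truncn (4 / eta + 4 * (2 * L + 6) / e).
have N0 : 0 < N.+1%:R :> R by rewrite ltr0n.
have [|n Nn wn] := wv (Num.min (eta / 2) (e / 4)) N.
  by rewrite lt_min !divr_gt0.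
have [_ /(_ v eta (e / 8) vP (ltW e8) Tclose) wT] := wP n.
have nN : N.+1%:R <= n.+1%:R :> R by rewrite ler_nat ltnS.
have n0 : 0 < n.+1%:R :> R by rewrite ltr0n.
have b1 : 0 < 4 / eta by rewrite divr_gt0.
have b2 : 0 <= 4 * (2 * L + 6) / e.
  by rewrite divr_ge0 ?(ltW e0)// mulr_ge0// addr_ge0// mulr_ge0.
have big : 4 / eta + 4 * (2 * L + 6) / e < n.+1%:R.
  by apply: lt_le_trans nN; exact: truncnS_gt.
have small1 : 2 / n.+1%:R <= eta / 2.
  rewrite ler_pdivrMr//; have : 4 / eta < n.+1%:R by lra.
  by rewrite ltr_pdivrMr//; lra.
have small2 : (2 * L + 6) / n.+1%:R <= e / 4.
  rewrite ler_pdivrMr//; have : 4 * (2 * L + 6) / e < n.+1%:R by lra.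
  by rewrite ltr_pdivrMr//; lra.
have wv_eta t' : 0 <= t' -> t' <= 1 -> `|w n t' - v t'| + 2 / n.+1%:R <= eta.
  move=> t'0 t'1; have := wn t' t'0 t'1; rewrite le_min => /andP[h _].
  by rewrite [leRHS](splitr eta) lerD.
have := wn t t0 t1; rewrite le_min => /andP[_].
have := wT wv_eta t t0 t1; move: small2; move: ((2 * L + 6) / _) => z.
by rewrite !ler_norml; lra.
Qed.

End Profiles.

(** * Primitives of continuous functions on the unit interval *)

Section Primitives.
Context {R : realType}.
Implicit Types (f g h : R -> R) (a b c s t x : R).
Notation mu := (@lebesgue_measure R).

Lemma clamp01_id t : 0 <= t -> t <= 1 -> clamp01 t = t.
Proof. by case: clamp01P; lra. Qed.

Lemma clamp01_itv t : 0 <= clamp01 t <= 1.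
Proof. by case: clamp01P => *; rewrite ?lexx ?ler01//; apply/andP. Qed.

Lemma clamp01_lipschitz s t : `|clamp01 s - clamp01 t| <= `|s - t|.
Proof.
rewrite ler_norml; have := ler_norm (s - t); have := ler_norm (t - s).
rewrite (distrC t); have := normr_ge0 (s - t).
by do 2 case: clamp01P => *; apply/andP; split; lra.
Qed.

Lemma clamp01_continuous : continuous (@clamp01 R).
Proof.
move=> x; apply/cvgrPdist_lt => e e0; near=> y.
by rewrite (le_lt_trans (clamp01_lipschitz _ _))//; near: y; apply: cvgr_dist_lt.
Unshelve. all: by end_near. Qed.

Lemma is_derive_addf f g x df dg : is_derive x 1 f df -> is_derive x 1 g dg ->
  is_derive x 1 (fun y => f y + g y) (df + dg).
Proof. by move=> h1 h2; exact: is_deriveD. Qed.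

Lemma is_derive_mulf f g x df dg : is_derive x 1 f df -> is_derive x 1 g dg ->
  is_derive x 1 (fun y => f y * g y) (f x * dg + g x * df).
Proof. by move=> h1 h2; exact: is_deriveM. Qed.

Lemma is_derive_continuous f x df : is_derive x 1 f df -> {for x, continuous f}.
Proof. by move=> [/derivable1_diffP/differentiable_continuous]. Qed.

Lemma mvt_closed f df a b : a <= b ->
  (forall x, a <= x -> x <= b -> is_derive x 1 f (df x)) ->
  exists c, [/\ a <= c, c <= b & f b - f a = df c * (b - a)].
Proof.
move=> ab fdf; have [||c] := @MVT_segment R f df a b ab.
- by move=> x; rewrite in_itv /= => /andP[/ltW ax /ltW xb]; exact: fdf.
- apply: derivable_within_continuous => x; rewrite in_itv /= => /andP[ax xb].
  by have [] := fdf x ax xb.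
- by rewrite in_itv /= => /andP[ac cb] h; exists c.
Qed.

Lemma itv_integrable f a b : {within `[a, b], continuous f} ->
  mu.-integrable `[a, b] (EFin \o f).
Proof. by apply: continuous_compact_integrable; exact: segment_compact. Qed.

Lemma Rintegral_FTC2 f F a b : a <= b ->
  {within `[a, b], continuous f} -> {within `[a, b], continuous F} ->
  (forall x, a < x -> x < b -> is_derive x 1 F (f x)) ->
  \int[mu]_(s in `[a, b]) f s = F b - F a.
Proof.
rewrite le_eqVlt => /orP[/eqP->|ab] fc Fc Ff.
  by rewrite set_itv1 Rintegral_set1 subrr.
rewrite /Rintegral (@continuous_FTC2 R f F a b ab fc)//.
  have [Fo Fa Fb] := (continuous_within_itvP _ ab).1 Fc.
  split=> // x; rewrite in_itv /= => /andP[ax xb].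
  by have [] := Ff x ax xb.
move=> x; rewrite in_itv /= => /andP[ax xb].
by have [_] := Ff x ax xb; rewrite derive1E.
Qed.

(** A primitive of [g] on the unit interval. Extending [g] by constants and
    integrating from -1 makes the derivative two-sided at 0 and 1 as well. *)
Definition prim g t : R :=
  \int[mu]_(s in `[-1, t]) g (clamp01 s) - \int[mu]_(s in `[-1, 0]) g (clamp01 s).

Lemma prim0 g : prim g 0 = 0.
Proof. exact: subrr. Qed.

Lemma is_derive_prim g t : continuous (g \o clamp01) -> -1 < t ->
  is_derive t 1 (prim g) (g (clamp01 t)).
Proof.
move=> gc t1.
have t_u : t < t + 1 by rewrite ltrDl.
have [||d1 d2] := continuous_FTC1_closed t_u _ t1 (f := g \o clamp01).
- by apply: itv_integrable; exact: continuous_subspaceT.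
- exact: gc.
have dF := DeriveDef d1 (etrans (esym (derive1E _ _)) d2).
have := is_derive_addf dF (is_derive_cst (- \int[mu]_(s in `[-1, 0]) g (clamp01 s)) t 1).
by rewrite addr0.
Qed.

Lemma is_derive_prim01 g t : continuous (g \o clamp01) -> 0 <= t -> t <= 1 ->
  is_derive t 1 (prim g) (g t).
Proof.
move=> gc t0 t1; rewrite -{2}(clamp01_id t0 t1).
by apply: is_derive_prim => //; rewrite (lt_le_trans _ t0)// ltrN10.
Qed.

Lemma prim_clamp_continuous g : continuous (g \o clamp01) ->
  continuous (prim g \o clamp01).
Proof.
move=> gc x; apply: continuous_comp; first exact: clamp01_continuous.
have /andP[c0 c1] := clamp01_itv x.
exact: is_derive_continuous (is_derive_prim01 gc c0 c1).
Qed.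

Lemma prim_mvt g a b : continuous (g \o clamp01) -> 0 <= a -> a <= b -> b <= 1 ->
  exists c, [/\ 0 <= c, c <= 1 & prim g b - prim g a = g c * (b - a)].
Proof.
move=> gc a0 ab b1; have [x ax xb|c [ac cb h]] := @mvt_closed (prim g) g a b ab.
  by apply: is_derive_prim01 => //; [exact: le_trans ax|exact: le_trans b1].
by exists c; split=> //; [exact: le_trans ac|exact: le_trans b1].
Qed.

Lemma prim_dist g h (d : R) a b :
  continuous (g \o clamp01) -> continuous (h \o clamp01) ->
  (forall s, 0 <= s -> s <= 1 -> `|g s - h s| <= d) ->
  0 <= a -> a <= b -> b <= 1 ->
  `|(prim g b - prim g a) - (prim h b - prim h a)| <= d * (b - a).
Proof.
move=> gc hc gh a0 ab b1.
have [x ax xb|c [ac cb]] :=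
    @mvt_closed (fun x => prim g x + -1 * prim h x) (fun x => g x - h x) a b ab.
  have x0 := le_trans a0 ax; have x1 := le_trans xb b1.
  have dg := is_derive_prim01 gc x0 x1; have dh := is_derive_prim01 hc x0 x1.
  have := is_derive_addf dg (is_derive_mulf (is_derive_cst (-1 : R) x 1) dh).
  by rewrite mulr0 addr0 mulN1r.
move=> gh_eq.
have -> : (prim g b - prim g a) - (prim h b - prim h a) = (g c - h c) * (b - a).
  by rewrite -gh_eq; ring.
rewrite normrM (ger0_norm (_ : 0 <= b - a)) ?subr_ge0// ler_wpM2r ?subr_ge0//.
by apply: gh; [exact: le_trans ac|exact: le_trans b1].
Qed.

Lemma prim_dist0 g h (d : R) t :
  continuous (g \o clamp01) -> continuous (h \o clamp01) ->
  (forall s, 0 <= s -> s <= 1 -> `|g s - h s| <= d) ->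
  0 <= t -> t <= 1 -> `|prim g t - prim h t| <= d * t.
Proof.
move=> gc hc gh t0 t1; have := prim_dist gc hc gh (lexx 0) t0 t1.
by rewrite !prim0 !subr0.
Qed.

Lemma prim_bounds g (c : R) a b : continuous (g \o clamp01) ->
  (forall s, 0 <= s -> s <= 1 -> 0 <= g s <= c) ->
  0 <= a -> a <= b -> b <= 1 -> 0 <= prim g b - prim g a <= c.
Proof.
move=> gc gP a0 ab b1; have [x [x0 x1 ->]] := prim_mvt gc a0 ab b1.
have /andP[g0 g1] := gP x x0 x1; rewrite mulr_ge0 ?subr_ge0//=.
by rewrite (le_trans _ g1)// ler_piMr//; lra.
Qed.

Lemma prim_bounds0 g (c : R) t : continuous (g \o clamp01) ->
  (forall s, 0 <= s -> s <= 1 -> 0 <= g s <= c) ->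
  0 <= t -> t <= 1 -> 0 <= prim g t <= c.
Proof.
move=> gc gP t0 t1; have := prim_bounds gc gP (lexx 0) t0 t1.
by rewrite prim0 subr0.
Qed.

Lemma Rintegral_prim f g : continuous (g \o clamp01) ->
  (forall s, 0 <= s -> s <= 1 -> f s = g s) ->
  \int[mu]_(s in `[0, 1]) f s = prim g 1 - prim g 0.
Proof.
move=> gc fg.
transitivity (\int[mu]_(s in `[0, 1]) (g \o clamp01) s).
  apply: eq_Rintegral => s; rewrite inE /= in_itv /= => /andP[s0 s1].
  by rewrite clamp01_id// fg.
apply: Rintegral_FTC2 => //.
- exact: continuous_subspaceT.
- apply: derivable_within_continuous => x; rewrite in_itv /= => /andP[x0 x1].
  by have [] := is_derive_prim01 gc x0 x1.
- by move=> x x0 x1; rewrite /= clamp01_id ?ltW//; apply: is_derive_prim01 => //; exact: ltW.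
Qed.

End Primitives.

(** * Relative derivatives and the C^3 norm *)

Section C3functions.
Context {R : realType}.
Implicit Types (u v w : R -> R) (a b s t x d : R).

(** Derivatives relative to the unit interval are unique since no point of it is isolated. *)
Lemma nbhs01_proper t : 0 <= t -> t <= 1 -> ProperFilter (@nbhs01 R t).
Proof.
move=> t0 t1; apply: Build_ProperFilter_ex => A.
rewrite /nbhs01 /within /= => -[e /= e0 eA].
(* a point of the unit interval at distance less than e from t *)
pose r := Num.min (e / 2) (1 / 2).
have r0 : 0 < r by rewrite lt_min !divr_gt0.
have re : r < e by rewrite gt_min; apply/orP; left; lra.
have r1 : r <= 1 / 2 by rewrite ge_min lexx orbT.
have [th|th] := leP t (1 / 2).
  exists (t + r); apply: (eA (t + r)).
  - by rewrite /ball /= opprD addNKr normrN gtr0_norm.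
  - by apply/eqP; lra.
  - by rewrite /= in_itv /=; apply/andP; split; lra.
exists (t - r); apply: (eA (t - r)).
- by rewrite /ball /= opprB addrC subrK gtr0_norm.
- by apply/eqP; lra.
- by rewrite /= in_itv /=; apply/andP; split; lra.
Qed.

Lemma cvg_diffquot u v t d : 0 <= t -> t <= 1 -> is_derive t 1 v d ->
  (forall s, 0 <= s -> s <= 1 -> u s = v s) ->
  diffquot u t @ nbhs01 t --> d.
Proof.
move=> t0 t1 [dv dE] uv; apply/cvgrPdist_lt => e e0.
have /cvgrPdist_lt/(_ e e0) := dv.
rewrite -/(derive v t 1) dE => -[r /= r0 hr].
exists r => //= s st sNt; rewrite in_itv /= => /andP[s0 s1].
have := hr (s - t); rewrite /diffquot !uv// /ball /= sub0r normrN distrC.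
move=> /(_ st); rewrite subr_eq0 => /(_ sNt).
by rewrite [_%:A]mulr1 subrK mulrC.
Qed.

(** Relative derivatives see only the values on the unit interval, hence may be
    computed from any two-sided differentiable extension. *)
Lemma D01_eq u v t d : 0 <= t -> t <= 1 -> is_derive t 1 v d ->
  (forall s, 0 <= s -> s <= 1 -> u s = v s) ->
  derivable01 u t /\ D01 u t = d.
Proof.
move=> t0 t1 vd uv; have := cvg_diffquot t0 t1 vd uv.
have ? := nbhs01_proper t0 t1.
by move=> h; split; [apply/cvg_ex; exists d|exact/cvg_lim].
Qed.

(** The successive derivatives of a [C^3] function, given by extensions to the line. *)
Definition derivative_chain (U : nat -> R -> R) : Prop :=
  (forall j t, (j < 3)%N -> 0 <= t -> t <= 1 -> is_derive t 1 (U j) (U j.+1 t))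
  /\ {within `[0, 1], continuous (U 3)}.

Lemma D01n_chain (U : nat -> R -> R) j t : derivative_chain U ->
  (j <= 3)%N -> 0 <= t -> t <= 1 -> D01n j (U 0) t = U j t.
Proof.
move=> [UU _]; elim: j t => // j IH t j3 t0 t1.
have [_ <-] := D01_eq t0 t1 (UU j t j3 t0 t1) (fun s => IH s (ltnW j3)).
by [].
Qed.

Lemma chain_is_C3 (U : nat -> R -> R) : derivative_chain U -> is_C3 (U 0).
Proof.
move=> UP; split.
  move=> j t j3; rewrite in_itv /= => /andP[t0 t1].
  have [h _] := D01_eq t0 t1 (UP.1 j t j3 t0 t1) (fun s => D01n_chain UP (ltnW j3) (t := s)).
  exact: h.
apply: (subspace_eq_continuous _ UP.2) => t.
rewrite inE /= in_itv /= => /andP[t0 t1].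
exact/esym/(D01n_chain UP (leqnn 3)).
Qed.

Lemma supnorm01_le u c : (forall t, 0 <= t -> t <= 1 -> `|u t| <= c) ->
  supnorm01 u <= c.
Proof.
move=> uc; apply: ge_sup.
  by exists `|u 0|, 0 => //=; rewrite in_itv /= lexx ler01.
by move=> _ [t /= + <-]; rewrite in_itv /= => /andP[t0 t1]; exact: uc.
Qed.

Lemma norm3_le (U : nat -> R -> R) c : derivative_chain U -> 0 <= c ->
  (forall j t, (j <= 3)%N -> 0 <= t -> t <= 1 -> `|U j t| <= c) ->
  norm3 (U 0) <= c.
Proof.
move=> UP c0 Uc; apply: bigmax_le => // j _; apply: supnorm01_le => t t0 t1.
by have j3 := ltn_ord j; rewrite D01n_chain// Uc.
Qed.

Lemma norm3_ge (U : nat -> R -> R) c j t : derivative_chain U -> 0 <= t -> t <= 1 ->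
  (forall j t, (j <= 3)%N -> 0 <= t -> t <= 1 -> `|U j t| <= c) ->
  (j <= 3)%N -> `|U j t| <= norm3 (U 0).
Proof.
move=> UP t0 t1 Uc j3.
apply: (@le_trans _ _ (supnorm01 (D01n j (U 0)))).
  apply: ub_le_sup.
    exists c => _ [s /= + <-]; rewrite in_itv /= => /andP[s0 s1].
    by rewrite D01n_chain// Uc.
  by exists t; rewrite /= ?in_itv /= ?t0 ?t1// D01n_chain.
exact: (le_bigmax 0 (fun i : 'I_4 => supnorm01 (D01n i (U 0))) (Ordinal (j3 : (j < 4)%N))).
Qed.

End C3functions.

(** * Functions with prescribed third derivative *)

Section Beam.
Context {R : realType}.
Implicit Types (v w g : R -> R) (a b s t x d : R).
Notation mu := (@lebesgue_measure R).

(** The [j]-th derivative of the solution of [u''' = - v],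
    [u 0 = u' 0 = u'' 1 = 0]. *)
Definition beam v (j : nat) : R -> R :=
  let u2 := fun t => prim v 1 - prim v t in
  let u1 := prim u2 in
  nth (fun t => - v (clamp01 t)) [:: prim u1; u1; u2] j.
Arguments beam : simpl never.

Lemma profile_continuous rho L v : 0 <= L -> profile rho L v ->
  continuous (v \o clamp01).
Proof.
move=> L0 vP x; apply/cvgrPdist_lt => e e0.
have L1 : 0 < L + 1 by rewrite ltr_wpDl.
near=> y.
have le_ : `|(v \o clamp01) x - (v \o clamp01) y| <= (L + 1) * `|x - y|.
  apply: le_trans (profile_lipschitz L0 vP (clamp01_itv x) (clamp01_itv y)) _.
  by rewrite ler_pM ?lerDl// clamp01_lipschitz.
rewrite (le_lt_trans le_)// mulrC -ltr_pdivlMr//.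
by near: y; apply: cvgr_dist_lt => //; rewrite divr_gt0.
Unshelve. all: by end_near. Qed.

Section BeamOfContinuous.
Variable v : R -> R.
Hypothesis vc : continuous (v \o clamp01).

Lemma beam2_continuous : continuous (beam v 2 \o clamp01).
Proof.
move=> x; apply: cvgB; first exact: cvg_cst.
exact: (prim_clamp_continuous vc).
Qed.

Lemma beam1_continuous : continuous (beam v 1 \o clamp01).
Proof. exact: prim_clamp_continuous beam2_continuous. Qed.

Lemma is_derive_beam2 t : 0 <= t -> t <= 1 -> is_derive t 1 (beam v 2) (beam v 3 t).
Proof.
move=> t0 t1.
have := is_derive_addf (is_derive_cst (prim v 1) t 1)
  (is_derive_mulf (is_derive_cst (-1 : R) t 1) (is_derive_prim01 vc t0 t1)).
rewrite mulr0 addr0 add0r mulN1r.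
rewrite (_ : (fun y => _ + _) = beam v 2); last first.
  by apply/funext => y; rewrite /= mulN1r.
by rewrite /beam /= clamp01_id.
Qed.

Lemma beam_chain : derivative_chain (beam v).
Proof.
split; last first.
  by apply: continuous_subspaceT => x; apply: cvgN; exact: vc.
move=> [|[|[|//]]] t _ t0 t1.
- exact: is_derive_prim01 beam1_continuous t0 t1.
- exact: is_derive_prim01 beam2_continuous t0 t1.
- exact: is_derive_beam2.
Qed.

End BeamOfContinuous.

(** Each integration is over an interval of length at most 1, so it does not
    increase distances. *)
Lemma beam_dist v w d j t : continuous (v \o clamp01) -> continuous (w \o clamp01) ->
  (forall s, 0 <= s -> s <= 1 -> `|w s - v s| <= d) ->
  0 <= t -> t <= 1 -> `|beam w j t - beam v j t| <= d.
Proof.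
move=> vc wc wv.
have d0 : 0 <= d by rewrite (le_trans (normr_ge0 _) (wv 0 _ _)).
have dt s : 0 <= s -> s <= 1 -> d * (1 - s) <= d.
  by move=> s0 s1; rewrite ler_piMr// gerBl.
have dt' s : 0 <= s -> s <= 1 -> d * s <= d.
  by move=> s0 s1; rewrite ler_piMr.
have h2 s : 0 <= s -> s <= 1 -> `|beam w 2 s - beam v 2 s| <= d.
  move=> s0 s1; rewrite (le_trans _ (dt s s0 s1))//.
  exact: prim_dist.
have h1 s : 0 <= s -> s <= 1 -> `|beam w 1 s - beam v 1 s| <= d.
  move=> s0 s1; rewrite (le_trans _ (dt' s s0 s1))//.
  exact: (prim_dist0 (beam2_continuous wc) (beam2_continuous vc) h2 s0 s1).
have h0 s : 0 <= s -> s <= 1 -> `|beam w 0 s - beam v 0 s| <= d.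
  move=> s0 s1; rewrite (le_trans _ (dt' s s0 s1))//.
  exact: (prim_dist0 (beam1_continuous wc) (beam1_continuous vc) h1 s0 s1).
move=> t0 t1; case: j => [|[|[|j]]]; [exact: h0|exact: h1|exact: h2|].
have -> : beam w j.+3 t - beam v j.+3 t = - (w t - v t).
  by rewrite /beam /= !nth_nil clamp01_id// opprB opprK addrC.
by rewrite normrN; exact: wv.
Qed.

Lemma beam_norm3_dist v w d : continuous (v \o clamp01) -> continuous (w \o clamp01) ->
  (forall s, 0 <= s -> s <= 1 -> `|w s - v s| <= d) ->
  norm3 (beam w 0 - beam v 0) <= d.
Proof.
move=> vc wc wv.
have d0 : 0 <= d by rewrite (le_trans (normr_ge0 _) (wv 0 _ _)).
apply: (@norm3_le _ (fun j t => beam w j t - beam v j t)) => //.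
  have [dv v3] := beam_chain vc; have [dw w3] := beam_chain wc; split.
    by move=> j t j3 t0 t1; apply: is_deriveB; [exact: dw|exact: dv].
  by move=> x; apply: cvgB; [exact: w3|exact: v3].
by move=> j t _ t0 t1; exact: beam_dist.
Qed.

Lemma beam_bounds rho L v j t : 0 <= L -> profile rho L v -> (j < 3)%N ->
  0 <= t -> t <= 1 -> 0 <= beam v j t <= rho.
Proof.
move=> L0 vP; have vc := profile_continuous L0 vP.
have rho0 : 0 <= rho by have /andP[] := profile_bounds vP (lexx 0) ler01; exact: le_trans.
have h2 s : 0 <= s -> s <= 1 -> 0 <= beam v 2 s <= rho.
  move=> s0 s1; apply: (prim_bounds vc) => // x x0 x1.
  exact: profile_bounds vP x0 x1.
have h1 s : 0 <= s -> s <= 1 -> 0 <= beam v 1 s <= rho.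
  exact: (prim_bounds0 (beam2_continuous vc) h2).
have h0 s : 0 <= s -> s <= 1 -> 0 <= beam v 0 s <= rho.
  exact: (prim_bounds0 (beam1_continuous vc) h1).
by case: j => [|[|[|//]]] _; [exact: h0|exact: h1|exact: h2].
Qed.

(** Integrating over a length at most 1 keeps values between 0 and [rho], and the
    third derivative attains [- rho] at 0. *)
Lemma beam_boundaryK rho L v : 0 <= L -> profile rho L v ->
  boundaryK rho (beam v 0).
Proof.
move=> L0 vP; have UP := beam_chain (profile_continuous L0 vP).
have beamK j t := beam_bounds (j := j) (t := t) L0 vP.
have vK t : 0 <= t -> t <= 1 -> 0 <= v t <= rho := profile_bounds vP (t := t).
have rho0 : 0 <= rho by have /andP[] := vK 0 (lexx 0) ler01; exact: le_trans.
have v3 t : 0 <= t -> t <= 1 -> beam v 3 t = - v t by move=> t0 t1; rewrite /beam /= clamp01_id.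
have bounded j t : (j <= 3)%N -> 0 <= t -> t <= 1 -> `|beam v j t| <= rho.
  rewrite leq_eqVlt => /orP[/eqP->|j3] t0 t1.
    by rewrite v3// normrN; have /andP[h1 h2] := vK t t0 t1; rewrite ger0_norm.
  by have /andP[h1 h2] := beamK j t j3 t0 t1; rewrite ger0_norm.
split; last first.
  apply/eqP; rewrite eq_le norm3_le//=.
  have <- : `|beam v 3 0| = rho.
    by rewrite v3// normrN; have [-> _ _] := vP; rewrite ger0_norm.
  exact: (norm3_ge UP (lexx 0) ler01 bounded).
split; first exact: chain_is_C3.
move=> t; rewrite in_itv => /andP[t0 t1].
rewrite !(D01n_chain UP)//; split.
- by have /andP[] := beamK 0 t isT t0 t1.
- by have /andP[] := beamK 1%N t isT t0 t1.
- by have /andP[] := beamK 2%N t isT t0 t1.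
- by rewrite v3// opprK; have /andP[] := vK t t0 t1.
Qed.

End Beam.

(** * The Green function *)

Section Green.
Context {R : realType}.
Implicit Types (f v w g : R -> R) (a b s t x d : R).
Notation mu := (@lebesgue_measure R).

Lemma Rintegral_split f a b c : a <= c -> c <= b ->
  {within `[a, b], continuous f} ->
  \int[mu]_(s in `[a, b]) f s =
  \int[mu]_(s in `[a, c]) f s + \int[mu]_(s in `[c, b]) f s.
Proof.
move=> ac cb fc; have fi := itv_integrable fc.
rewrite -(@Rintegral_itv_obnd_cbnd R c (BRight b)); last first.
  apply: integrableS fi => //.
  move=> x; rewrite /= !in_itv /= => /andP[cx ->]; rewrite andbT.
  exact: le_trans ac (ltW cx).
rewrite -(Rintegral_itvB fi) ?bnd_simp//.
by rewrite addrC subrK.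
Qed.

Lemma green_minmax t s : green t s =
  (3 * Num.min t s * Num.min t s * Num.max t s
   - Num.min t s * Num.min t s * Num.min t s) / 6.
Proof. by rewrite /green; have [ts|st] := leP t s; congr (_ / _); ring. Qed.

Lemma green_continuous t : continuous (green t).
Proof.
move=> x; have mc : {for x, continuous (fun s => Num.min t s)}.
  exact: (@continuous_min R R (cst t) id x (@cst_continuous _ _ t x) (@cvg_id _ (nbhs x))).
have Mc : {for x, continuous (fun s => Num.max t s)}.
  exact: (@continuous_max R R (cst t) id x (@cst_continuous _ _ t x) (@cvg_id _ (nbhs x))).
rewrite (_ : green t = fun s => (3 * Num.min t s * Num.min t s * Num.max t s
   - Num.min t s * Num.min t s * Num.min t s) / 6); last first.
  by apply/funext => s; exact: green_minmax.
apply: cvgM; last exact: cvg_cst.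
apply: cvgB.
  by apply: cvgM => //; apply: cvgM => //; apply: cvgM => //; exact: cvg_cst.
by apply: cvgM => //; apply: cvgM.
Qed.

Lemma continuous_within_itv f a b : (forall x, a <= x -> x <= b -> {for x, continuous f}) ->
  {within `[a, b], continuous f}.
Proof.
move=> fc; apply: continuous_in_subspaceT => x.
by rewrite inE /= in_itv /= => /andP[]; exact: fc.
Qed.

Variables (phi v : R -> R) (lambda h : R).
Hypothesis phic : continuous (phi \o clamp01).
Hypothesis vc : continuous (v \o clamp01).
Hypothesis v_eq : forall t, 0 <= t -> t <= 1 ->
  v t = lambda * (h + (prim phi 1 - prim phi t)).

Lemma is_derive_beam3 x : 0 < x -> x < 1 ->
  is_derive x 1 (beam v 3) (lambda * phi x).
Proof.
move=> x0 x1.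
have dphi := is_derive_prim01 phic (ltW x0) (ltW x1).
have := is_derive_addf (is_derive_cst (- (lambda * (h + prim phi 1))) x 1)
  (is_derive_mulf (is_derive_cst lambda x 1) dphi).
rewrite mulr0 addr0 add0r; apply: near_eq_is_derive.
near=> y; rewrite /beam /= clamp01_id; last 2 first.
- by rewrite ltW//; near: y; apply: lt_nbhsr.
- by rewrite ltW//; near: y; apply: lt_nbhsl.
rewrite v_eq; first by ring.
- by rewrite ltW//; near: y; apply: lt_nbhsr.
- by rewrite ltW//; near: y; apply: lt_nbhsl.
Unshelve. all: by end_near. Qed.

Lemma beam_continuous01 j x : (j <= 3)%N -> 0 <= x -> x <= 1 ->
  {for x, continuous (beam v j)}.
Proof.
rewrite leq_eqVlt => /orP[/eqP-> _ _|j3 x0 x1].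
  by apply: cvgN; exact: vc.
exact: is_derive_continuous ((beam_chain vc).1 j x j3 x0 x1).
Qed.

Lemma is_derive_idf x : is_derive x 1 (fun y : R => y) 1.
Proof. exact: is_derive_id. Qed.

(** With [k = green t], a primitive of [k u''''] on each side of the diagonal is
    [k u''' - k' u'' + k'' u' - k''' u]. On the left of [t] the third derivative of
    [k] is -1 and contributes [u t]; at the diagonal the remaining terms of both sides
    cancel, at 0 all terms vanish, and at 1 only
    [k 1 * u''' 1 = - lambda * gamma01 t * h] is left. *)
Lemma green_identity t : 0 <= t -> t <= 1 ->
  beam v 0 t = lambda * (gamma01 t * h +
    \int[mu]_(s in `[0, 1]) (green t s * phi s)).
Proof.
move=> t0 t1.
pose F s := lambda * (green t s * phi (clamp01 s)).
have gphi_c : continuous (fun s => green t s * phi (clamp01 s)).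
  by move=> x; apply: cvgM; [exact: green_continuous|exact: phic].
have F_c : continuous F by move=> x; apply: cvgM; [exact: cvg_cst|exact: gphi_c].
have -> : lambda * (gamma01 t * h + \int[mu]_(s in `[0, 1]) (green t s * phi s)) =
    lambda * gamma01 t * h + \int[mu]_(s in `[0, 1]) F s.
  rewrite RintegralZl//; last by apply: itv_integrable; exact: continuous_subspaceT.
  rewrite mulrDr mulrA; congr (_ + _ * _); apply: eq_Rintegral => s.
  by rewrite inE /= in_itv /= => /andP[s0 s1]; rewrite clamp01_id.
rewrite (Rintegral_split t0 t1 (continuous_subspaceT F_c)).
pose k1 s : R := s * s * (3 * t + -1 * s) * 6^-1.
pose dk1 s : R := s * t + - (1 / 2) * (s * s).
pose k2 s : R := t * t / 2 * s + - (t * t * t / 6).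
have dk1P x : is_derive x 1 k1 (dk1 x).
  have di := is_derive_idf x; have dc (c : R) := is_derive_cst c x 1.
  apply: is_derive_eq (is_derive_mulf (is_derive_mulf (is_derive_mulf di di)
    (is_derive_addf (dc (3 * t)) (is_derive_mulf (dc (-1)) di))) (dc 6^-1)) _.
  by rewrite /dk1 /cst /=; field.
have ddk1P x : is_derive x 1 dk1 (t + -1 * x).
  have di := is_derive_idf x; have dc (c : R) := is_derive_cst c x 1.
  apply: is_derive_eq (is_derive_addf (is_derive_mulf di (dc t))
    (is_derive_mulf (dc (- (1 / 2))) (is_derive_mulf di di))) _.
  by rewrite /cst /=; field.
have dddk1P x : is_derive x 1 (fun x => t + -1 * x) (-1).
  have di := is_derive_idf x; have dc (c : R) := is_derive_cst c x 1.
  by apply: is_derive_eq (is_derive_addf (dc t) (is_derive_mulf (dc (-1)) di)) _; rewrite /cst /=; ring.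
have dk2P x : is_derive x 1 k2 (t * t / 2).
  have di := is_derive_idf x; have dc (c : R) := is_derive_cst c x 1.
  by apply: is_derive_eq (is_derive_addf (is_derive_mulf (dc (t * t / 2)) di)
    (dc (- (t * t * t / 6)))) _; rewrite /cst /=; ring.
pose E1 s := k1 s * beam v 3 s + (-1) * (dk1 s * beam v 2 s) +
  (t + -1 * s) * beam v 1 s + beam v 0 s.
pose E2 s := k2 s * beam v 3 s + - (t * t / 2) * beam v 2 s.
have bc j x := beam_continuous01 (j := j) (x := x).
have bd j x := (beam_chain vc).1 j x.
have -> : \int[mu]_(s in `[0, t]) F s = E1 t - E1 0.
  apply: (@Rintegral_FTC2 R F E1 0 t t0); first exact: continuous_subspaceT.
    apply: continuous_within_itv => x x0 xt; have x1 := le_trans xt t1.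
    apply: cvgD; [apply: cvgD; [apply: cvgD|]|exact: bc].
    - by apply: cvgM; [exact: is_derive_continuous (dk1P x)|exact: bc].
    - apply: cvgM; [exact: cvg_cst|].
      by apply: cvgM; [exact: is_derive_continuous (ddk1P x)|exact: bc].
    - by apply: cvgM; [exact: is_derive_continuous (dddk1P x)|exact: bc].
  move=> x x0 xt; have x1 := lt_le_trans xt t1.
  have [x0' x1'] := (ltW x0, ltW x1).
  apply: is_derive_eq (is_derive_addf (is_derive_addf (is_derive_addf
    (is_derive_mulf (dk1P x) (is_derive_beam3 x0 x1))
    (is_derive_mulf (is_derive_cst (-1 : R) x 1)
      (is_derive_mulf (ddk1P x) (bd 2%N x isT x0' x1'))))
    (is_derive_mulf (dddk1P x) (bd 1%N x isT x0' x1'))) (bd 0%N x isT x0' x1')) _.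
  rewrite /F clamp01_id// (_ : green t x = k1 x); first by rewrite /cst /=; ring.
  by rewrite /green leNgt xt /k1 /=; field.
have -> : \int[mu]_(s in `[t, 1]) F s = E2 1 - E2 t.
  apply: (@Rintegral_FTC2 R F E2 t 1 t1); first exact: continuous_subspaceT.
    apply: continuous_within_itv => x tx x1; have x0 := le_trans t0 tx.
    apply: cvgD; apply: cvgM; [exact: is_derive_continuous (dk2P x)|exact: bc|exact: cvg_cst|exact: bc].
  move=> x tx x1; have x0 := le_lt_trans t0 tx.
  have [x0' x1'] := (ltW x0, ltW x1).
  apply: is_derive_eq (is_derive_addf
    (is_derive_mulf (dk2P x) (is_derive_beam3 x0 x1))
    (is_derive_mulf (is_derive_cst (- (t * t / 2)) x 1) (bd 2%N x isT x0' x1'))) _.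
  rewrite /F clamp01_id// (_ : green t x = k2 x); first by rewrite /cst /=; ring.
  by rewrite /green ltW// /k2; field.
have b00 : beam v 0 0 = 0 by exact: prim0.
have b10 : beam v 1 0 = 0 by exact: prim0.
have b21 : beam v 2 1 = 0 by exact: subrr.
have b31 : beam v 3 1 = - (lambda * h).
  by rewrite /beam /= clamp01_id// v_eq// subrr addr0.
rewrite /E1 /E2 b00 b10 b21 b31 /k1 /dk1 /k2 /gamma01.
by field.
Qed.

End Green.

(** * The normalized integral operator *)

Section Nonlinearity.
Context {R : realType}.

Lemma continuous_pair (X U V : topologicalType) (f : X -> U) (g : X -> V) (x : X) :
  {for x, continuous f} -> {for x, continuous g} ->
  {for x, continuous (fun y => (f y, g y))}.
Proof. by move=> fc gc; exact: (cvg_pair fc gc). Qed.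

(** Heine-Cantor, from the near-covering form of compactness. *)
Lemma compact_uniformly_continuous (X : pseudoMetricType R) (A : set X)
    (f : X -> R) (e : R) : compact A -> {within A, continuous f} -> 0 < e ->
  exists2 d : R, 0 < d & forall x y, A x -> A y -> ball x d y -> `|f x - f y| <= e.
Proof.
move=> /compact_near_coveringP Acover /subspace_continuousP fc e0.
pose P (d : R) (x : X) := A x -> forall y, A y -> ball x d y -> `|f x - f y| <= e.
have [] := Acover R (0^'+) P _ _.
  move=> x Ax.
  have /cvgrPdist_lt/(_ (e / 2)) := fc x Ax.
  rewrite divr_gt0// => /(_ isT); rewrite /within /= => /nbhs_ballP[r /= r0 xr].
  have r2 : 0 < r / 2 by rewrite divr_gt0.
  exists (ball x (r / 2), [set d | d < r / 2]).
    by split; [exact: nbhsx_ballx|exact: nbhs_right_lt].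
  move=> [x' d] [/= xx' dr] Ax' y Ay x'y.
  have r_half : r = r / 2 + r / 2 by rewrite -splitr.
  have xy : ball x r y.
    by rewrite r_half; apply: ball_triangle xx' _; apply: le_ball x'y; exact: ltW.
  have xx'r : ball x r x' by apply: le_ball xx'; rewrite [leRHS]r_half lerDl ltW.
  have fxy : `|f x - f y| < e / 2 := xr _ xy Ay.
  have fxx' : `|f x - f x'| < e / 2 := xr _ xx'r Ax'.
  by move: fxy fxx'; rewrite !ltr_norml ler_norml; lra.
move=> d /= d0 h; exists (d / 2); first by rewrite divr_gt0.
move=> x y Ax Ay; apply: (h (d / 2)) => //=; last by rewrite divr_gt0.
by rewrite sub0r normrN gtr0_norm ?divr_gt0// ltr_pdivrMr// ltr_pMr// ltr1n.
Qed.

Lemma dist_add2 (a b c d e : R) : `|a - b| <= e -> `|c - d| <= e ->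
  `|(a + c) - (b + d)| <= 2 * e.
Proof. by rewrite !ler_norml; lra. Qed.

(** The quotient rule for differences; [l] is the length of the interval over which
    [x] and [y] are increments. *)
Lemma quotient_dist (rho m M e l x y p q : R) : 0 < rho -> 0 < m ->
  m <= p -> m <= q -> `|p - q| <= 2 * e -> `|x - y| <= e * l ->
  0 <= y <= M * l ->
  `|rho * x / p - rho * y / q| <= rho * (m^-1 + 2 * M / m ^+ 2) * (e * l).
Proof.
move=> rho0 m0 mp mq pq xy /andP[y0 yM].
have p0 := lt_le_trans m0 mp; have q0 := lt_le_trans m0 mq.
have -> : rho * x / p - rho * y / q = rho * ((x - y) / p + y * (q - p) / (p * q)).
  by field; rewrite !gt_eqF.
have -> : rho * (m^-1 + 2 * M / m ^+ 2) * (e * l) =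
    rho * (e * l / m + M * l * (2 * e) / (m * m)).
  by field; rewrite gt_eqF.
rewrite normrM (gtr0_norm rho0) ler_pM2l// (le_trans (ler_normD _ _))// lerD//.
  rewrite normrM normfV (gtr0_norm p0) ler_pM// ?invr_ge0 ?(ltW p0)//.
  by rewrite lef_pV2.
rewrite !normrM normfV (gtr0_norm (mulr_gt0 p0 q0)) (ger0_norm y0) (distrC q).
apply: ler_pM => //; [exact: mulr_ge0|by rewrite invr_ge0 mulr_ge0 ?ltW| |].
  exact: ler_pM.
by rewrite lef_pV2 ?posrE ?mulr_gt0// ler_pM// ltW.
Qed.

Lemma Pibox_compact (rho : R) : compact (Pibox rho).
Proof. by do 4![apply: compact_setX; last exact: segment_compact]; exact: segment_compact. Qed.

End Nonlinearity.

Section Operator.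
Context {R : realType}.
Notation mu := (@lebesgue_measure R).
Variables (rho : R) (f : R * R * R * R * R -> R) (H : (R -> R) -> R).
Variables (delta_lo delta_hi : R -> R) (eta_lo eta_hi : R).
Hypothesis rho_gt0 : 0 < rho.
Hypothesis f_cont : {within Pibox rho, continuous f}.
Hypothesis delta_lo_cont : {within `[0, 1], continuous delta_lo}.
Hypothesis delta_lo_ge0 : forall t : R, t \in `[0, 1] -> 0 <= delta_lo t.
Hypothesis f_ge : forall t u v w z : R, Pibox rho (t, u, v, w, z) ->
  delta_lo t <= f (t, u, v, w, z).
Hypothesis H_cont : norm3_continuous_on (closedK rho) H.
Hypothesis eta_lo_ge0 : 0 <= eta_lo.
Hypothesis H_ge : forall u : R -> R, boundaryK rho u -> eta_lo <= H u.
Hypothesis lo_gt0 : 0 < eta_lo + \int[mu]_(s in `[0, 1]) delta_lo s.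
Hypothesis delta_hi_cont : {within `[0, 1], continuous delta_hi}.
Hypothesis f_le : forall t u v w z : R, Pibox rho (t, u, v, w, z) ->
  f (t, u, v, w, z) <= delta_hi t.
Hypothesis H_le : forall u : R -> R, boundaryK rho u -> H u <= eta_hi.

Definition load (v : R -> R) (s : R) : R :=
  f (s, beam v 0 s, beam v 1 s, beam v 2 s, beam v 3 s).

(** The denominator of the normalized equation: [- u''' 0 / lambda] for a solution. *)
Definition root_shear (v : R -> R) : R := H (beam v 0) + prim (load v) 1.

(** The right-hand side of the equation for [- u'''], with [lambda] replaced by the
    value that the norm condition at 0 forces. *)
Definition shear (v : R -> R) (t : R) : R :=
  rho * (H (beam v 0) + (prim (load v) 1 - prim (load v) t)) / root_shear v.

Lemma shear_increment v a b : shear v a - shear v b =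
  rho * (prim (load v) b - prim (load v) a) / root_shear v.
Proof.
rewrite /shear -mulrBl -mulrBr; congr (_ * _ / _).
by move: (H _) (prim _ 1) (prim _ a) (prim _ b) => h p x y; ring.
Qed.

Section OneProfile.
Variables (L : R) (v : R -> R).
Hypothesis L0 : 0 <= L.
Hypothesis vP : profile rho L v.
Let vc := profile_continuous L0 vP.

Lemma beam3E t : 0 <= t -> t <= 1 -> beam v 3 t = - v t.
Proof. by move=> t0 t1; rewrite /beam /= clamp01_id. Qed.

Lemma Pibox_beam s : 0 <= s -> s <= 1 ->
  Pibox rho (s, beam v 0 s, beam v 1 s, beam v 2 s, beam v 3 s).
Proof.
move=> s0 s1; have b j (j3 : (j < 3)%N) := beam_bounds L0 vP j3 s0 s1.
have /andP[v0 v1] := profile_bounds vP s0 s1.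
by do 4?split; rewrite /= in_itv /= ?s0 ?b// beam3E// lerN2 v1 oppr_le0.
Qed.

(** [f] is only continuous relative to the box, but the curve stays in it. *)
Lemma load_continuous : continuous (load v \o clamp01).
Proof.
move=> x.
pose G s : R * R * R * R * R :=
  (s, beam v 0 s, beam v 1 s, beam v 2 s, beam v 3 s).
have GP y : Pibox rho (G (clamp01 y)).
  by have /andP[c0 c1] := clamp01_itv y; exact: Pibox_beam.
have bc j : (j <= 3)%N -> {for x, continuous (beam v j \o clamp01)}.
  move=> j3; have /andP[c0 c1] := clamp01_itv x.
  by apply: continuous_comp; [exact: clamp01_continuous|exact: beam_continuous01].
have Gc : {for x, continuous (G \o clamp01)}.
  exact: (continuous_pair (continuous_pair (continuous_pair (continuous_pair
    (@clamp01_continuous R x) (bc 0%N isT)) (bc 1%N isT)) (bc 2%N isT)) (bc 3%N isT)).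
have /subspace_continuousP fc := f_cont.
apply: (cvg_comp (G \o clamp01) f _ (fc _ (GP x))).
move=> A /Gc GA; change (nbhs x (fun y => A (G (clamp01 y)))).
have {}GA : nbhs x (fun y => Pibox rho (G (clamp01 y)) -> A (G (clamp01 y))) := GA.
by apply: filterS GA => y /(_ (GP y)).
Qed.

Lemma load_ge s : 0 <= s -> s <= 1 -> delta_lo s <= load v s.
Proof. by move=> s0 s1; apply: f_ge; exact: Pibox_beam. Qed.

Lemma load_le s : 0 <= s -> s <= 1 -> load v s <= delta_hi s.
Proof. by move=> s0 s1; apply: f_le; exact: Pibox_beam. Qed.

Lemma load_integral : \int[mu]_(s in `[0, 1]) load v s = prim (load v) 1.
Proof. by rewrite (Rintegral_prim load_continuous)// prim0 subr0. Qed.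

Lemma load_within : {within `[0, 1], continuous (load v)}.
Proof.
apply: (@subspace_eq_continuous _ _ _ (load v \o clamp01)).
  move=> t; rewrite inE /= in_itv /= => /andP[t0 t1]; rewrite clamp01_id//.
exact: continuous_subspaceT load_continuous.
Qed.

Lemma root_shear_ge : eta_lo + \int[mu]_(s in `[0, 1]) delta_lo s <= root_shear v.
Proof.
rewrite /root_shear -load_integral lerD ?H_ge//; first exact: beam_boundaryK vP.
apply: le_Rintegral => //; [exact: itv_integrable|exact/itv_integrable/load_within|].
by move=> s; rewrite /= in_itv /= => /andP[s0 s1]; exact: load_ge.
Qed.

Lemma root_shear_le : root_shear v <= eta_hi + \int[mu]_(s in `[0, 1]) delta_hi s.
Proof.
rewrite /root_shear -load_integral lerD ?H_le//; first exact: beam_boundaryK vP.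
apply: le_Rintegral => //; [exact/itv_integrable/load_within|exact: itv_integrable|].
by move=> s; rewrite /= in_itv /= => /andP[s0 s1]; exact: load_le.
Qed.

Lemma root_shear_gt0 : 0 < root_shear v.
Proof. exact: lt_le_trans root_shear_ge. Qed.

Lemma load_ge0 s : 0 <= s -> s <= 1 -> 0 <= load v s.
Proof.
move=> s0 s1; apply: le_trans (load_ge s0 s1).
by apply: delta_lo_ge0; rewrite in_itv /= s0.
Qed.

Lemma load_increment M a b : (forall s, 0 <= s -> s <= 1 -> delta_hi s <= M) ->
  0 <= a -> a <= b -> b <= 1 ->
  0 <= prim (load v) b - prim (load v) a <= M * (b - a).
Proof.
move=> hiM a0 ab b1.
have [c [c0 c1 ->]] := prim_mvt load_continuous a0 ab b1.
rewrite mulr_ge0 ?load_ge0 ?subr_ge0//= ler_wpM2r ?subr_ge0//.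
by rewrite (le_trans (load_le c0 c1))// hiM.
Qed.

(** At 0 the quotient is 1, and its increments are those of a primitive of the load
    divided by a denominator bounded below. *)
Lemma shear_profile M : (forall s, 0 <= s -> s <= 1 -> delta_hi s <= M) -> 0 <= M ->
  profile rho (rho * M / (eta_lo + \int[mu]_(s in `[0, 1]) delta_lo s)) (shear v).
Proof.
move=> hiM M0; have t0 := root_shear_gt0.
have Hge := H_ge (beam_boundaryK L0 vP).
split.
- by rewrite /shear prim0 subr0 mulfK// gt_eqF.
- rewrite /shear subrr addr0; apply: divr_ge0; last exact: ltW.
  by apply: mulr_ge0; [exact: ltW|exact: le_trans Hge].
move=> a b a0 ab b1.
have /andP[i0 i1] := load_increment hiM a0 ab b1.
rewrite -[X in X && _]subr_ge0 -[X in _ && X]lerBlDl (shear_increment v a b).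
rewrite divr_ge0 ?mulr_ge0 ?(ltW rho_gt0) ?(ltW t0)//=.
set m := eta_lo + _; rewrite ler_pdivrMr//.
apply: (@le_trans _ _ (rho * (M * (b - a)))); first by rewrite ler_pM2l.
rewrite (_ : rho * M / m * (b - a) * root_shear v = rho * (M * (b - a)) * (root_shear v / m)); last by ring.
rewrite ler_peMr ?mulr_ge0 ?subr_ge0 ?(ltW rho_gt0)//.
by rewrite ler_pdivlMr// mul1r root_shear_ge.
Qed.

End OneProfile.

(** The numerical functional [H] is continuous at [v] only, whereas the load depends
    uniformly on [v] by compactness of the box; the latter is what gives closeness of
    increments relative to [b - a]. *)
Lemma shear_continuous M L v (eps : R) :
  (forall s, 0 <= s -> s <= 1 -> delta_hi s <= M) -> 0 <= M -> 0 <= L ->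
  profile rho L v -> 0 < eps ->
  exists2 eta : R, 0 < eta & forall w, profile rho L w ->
    (forall t, 0 <= t -> t <= 1 -> `|w t - v t| <= eta) ->
    forall a b, 0 <= a -> a <= b -> b <= 1 ->
      `|(shear w a - shear w b) - (shear v a - shear v b)| <= eps * (b - a).
Proof.
move=> hiM M0 L0 vP eps0.
pose m := eta_lo + \int[mu]_(s in `[0, 1]) delta_lo s.
have m0 : 0 < m := lo_gt0.
have K0 : 0 < rho * (m^-1 + 2 * M / m ^+ 2).
  apply: mulr_gt0 => //; apply: ltr_pwDl; first by rewrite invr_gt0.
  by apply: divr_ge0; [apply: mulr_ge0|exact: sqr_ge0].
set K := rho * _ in K0; pose e := eps / K.
have e0 : 0 < e by rewrite divr_gt0.
have inK w : profile rho L w -> closedK rho (beam w 0).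
  by move=> wP; have [wK wn] := beam_boundaryK L0 wP; split=> //; rewrite wn.
have [dH dH0 Hclose] := H_cont (inK v vP) e0.
have [df df0 fclose] := compact_uniformly_continuous (@Pibox_compact R rho) f_cont e0.
pose eta := Num.min dH df / 2.
have min0 : 0 < Num.min dH df by rewrite lt_min dH0.
have eta0 : 0 < eta by rewrite divr_gt0.
have eta_min : eta < Num.min dH df by rewrite ltr_pdivrMr// ltr_pMr// ltr1n.
exists eta => // w wP wv a b a0 ab b1.
have [vc wc] := (profile_continuous L0 vP, profile_continuous L0 wP).
have Hwv : `|H (beam w 0) - H (beam v 0)| <= e.
  apply/ltW/Hclose; first exact: inK.
  rewrite (le_lt_trans (beam_norm3_dist vc wc wv))// (lt_le_trans eta_min)//.
  by rewrite ge_min lexx.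
have fwv s : 0 <= s -> s <= 1 -> `|load w s - load v s| <= e.
  move=> s0 s1; apply: fclose; [exact: Pibox_beam wP _ _ _|exact: Pibox_beam vP _ _ _|].
  have bwv j : `|beam w j s - beam v j s| < df.
    rewrite (le_lt_trans (beam_dist j vc wc wv s0 s1))// (lt_le_trans eta_min)//.
    by rewrite ge_min lexx orbT.
  exact: (conj (conj (conj (conj (ballxx s df0) (bwv 0%N)) (bwv 1%N)) (bwv 2%N)) (bwv 3%N)).
have lw := load_continuous L0 wP; have lv := load_continuous L0 vP.
have Tw := root_shear_ge L0 wP; have Tv := root_shear_ge L0 vP; rewrite -/m in Tw Tv.
have Dwv : `|root_shear w - root_shear v| <= 2 * e.
  have := prim_dist0 lw lv fwv ler01 (lexx 1); rewrite mulr1.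
  exact: dist_add2 Hwv.
have iwv := prim_dist lw lv fwv a0 ab b1.
have iv := load_increment L0 vP hiM a0 ab b1.
rewrite (shear_increment w a b) (shear_increment v a b).
have ba0 : 0 <= b - a by rewrite subr_ge0.
have := quotient_dist rho_gt0 m0 Tw Tv Dwv iwv iv.
by rewrite -/K (_ : K * (e * (b - a)) = eps * (b - a))// mulrA (mulrC K) /e divfK// gt_eqF.
Qed.

End Operator.

Theorem theorem2p5 (R : realType) (rho : R) (rho_gt0 : 0 < rho)
  (f : R * R * R * R * R -> R) (H : (R -> R) -> R)
  (delta_lo delta_hi : R -> R) (eta_lo eta_hi : R)
  (f_cont : {within Pibox rho, continuous f})
  (delta_lo_cont : {within `[0, 1], continuous delta_lo})
  (delta_lo_ge0 : forall t : R, t \in `[0, 1] -> 0 <= delta_lo t)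
  (f_ge : forall t u v w z : R, Pibox rho (t, u, v, w, z) ->
            delta_lo t <= f (t, u, v, w, z))
  (H_cont : norm3_continuous_on (closedK rho) H)
  (H_bounded : [bounded H u | u in closedK rho])
  (eta_lo_ge0 : 0 <= eta_lo)
  (H_ge : forall u : R -> R, boundaryK rho u -> eta_lo <= H u)
  (lo_gt0 : 0 < eta_lo + \int[lebesgue_measure]_(s in `[0, 1]) delta_lo s)
  (delta_hi_cont : {within `[0, 1], continuous delta_hi})
  (delta_hi_ge0 : forall t : R, t \in `[0, 1] -> 0 <= delta_hi t)
  (f_le : forall t u v w z : R, Pibox rho (t, u, v, w, z) ->
            f (t, u, v, w, z) <= delta_hi t)
  (eta_hi_ge0 : 0 <= eta_hi)
  (H_le : forall u : R -> R, boundaryK rho u -> H u <= eta_hi) :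
  exists (lambda_rho : R) (u_rho : R -> R),
    [/\ 0 < lambda_rho,
        boundaryK rho u_rho,
        bvp_eigenpair f H lambda_rho u_rho,
        rho / (eta_hi + \int[lebesgue_measure]_(s in `[0, 1]) delta_hi s)
          <= lambda_rho &
        lambda_rho
          <= rho / (eta_lo + \int[lebesgue_measure]_(s in `[0, 1]) delta_lo s)].
Proof.
have [c c01 hic] := EVT_max ler01 delta_hi_cont.
pose M := delta_hi c; have M0 : 0 <= M := delta_hi_ge0 c c01.
have hiM s : 0 <= s -> s <= 1 -> delta_hi s <= M.
  by move=> s0 s1; apply: hic; rewrite in_itv /= s0.
set m := eta_lo + \int[lebesgue_measure]_(s in `[0, 1]) delta_lo s in lo_gt0 *.
pose L := rho * M / m.
have L0 : 0 <= L by rewrite divr_ge0 ?mulr_ge0// ltW.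
have L20 : 0 <= L + 2 by rewrite addr_ge0.
pose T := shear rho f H.
have TP L' v : profile rho L' v -> profile rho L (T v).
  move=> vP; have vP' := profile_weaken (ler_norm L') vP.
  exact: (shear_profile rho_gt0 f_cont delta_lo_cont delta_lo_ge0 f_ge eta_lo_ge0
    H_ge lo_gt0 f_le (normr_ge0 L') vP' hiM M0).
have Tcont v (eps : R) (vP : profile rho (L + 2) v) (eps0 : 0 < eps) :=
  shear_continuous rho_gt0 f_cont delta_lo_cont delta_lo_ge0 f_ge H_cont
    H_ge lo_gt0 f_le hiM M0 L20 vP eps0.
have [v vP vT] := profile_fixpoint (ltW rho_gt0) L0 TP Tcont.
have vK := beam_boundaryK L20 vP.
have vc := profile_continuous L20 vP.
have lc := load_continuous f_cont L20 vP.
have D_ge := root_shear_ge f_cont delta_lo_cont f_ge H_ge L20 vP; rewrite -/m in D_ge.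
have D_le := root_shear_le f_cont delta_hi_cont f_le H_le L20 vP.
have D0 : 0 < root_shear f H v := lt_le_trans lo_gt0 D_ge.
exists (rho / root_shear f H v), (beam v 0); split => //.
- by rewrite divr_gt0.
- split; first exact: chain_is_C3 (beam_chain vc).
    by case: vK => _ ->.
  move=> t; rewrite in_itv => /andP[t0 t1].
  have v_eq s : 0 <= s -> s <= 1 -> v s = rho / root_shear f H v *
      (H (beam v 0) + (prim (load f v) 1 - prim (load f v) s)).
    by move=> s0 s1; rewrite {1}vT// /T /shear mulrAC.
  rewrite (green_identity lc vc v_eq t0 t1); congr (_ * (_ + _)).
  apply: eq_Rintegral => s; rewrite inE => /itvP s01.
  by rewrite !(D01n_chain (beam_chain vc)) ?s01.
- by rewrite ler_pM2l// lef_pV2 ?posrE// (lt_le_trans D0).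
- by rewrite ler_pM2l// lef_pV2 ?posrE.
Qed.
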